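(* Let $T\subset\mathbb{R}^3$ be a polyhedron. (i) For every integer $k\ge 0$, the composite weak curl $\nabla_w\times: V_k^{(2)}(T)\to V_k^{(3)}(T)$ and the weak divergence $\nabla_w\cdot: V_k^{(3)}(T)\to V_k^{(4)}(T)$ satisfy $$\nabla_w\cdot(\nabla_w\times\mathbf{u})=0\qquad\text{for all }\mathbf{u}\in V_k^{(2)}(T).$$ (ii) For every integer $k\ge 3$, the composite weak curl $\nabla_w\times: W_{k-1}^{(2)}(T)\to W_{k-2}^{(3)}(T)$ and the weak divergence $\nabla_w\cdot: W_{k-2}^{(3)}(T)\to W_{k-3}^{(4)}(T)$ satisfy $$\nabla_w\cdot(\nabla_w\times\mathbf{u})=0\qquad\text{for all }\mathbf{u}\in W_{k-1}^{(2)}(T).$$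
   Context: Geometry and notation. $T\subset\mathbb{R}^3$ is a (closed, bounded) polyhedron with flat polygonal faces, each edge being shared by exactly two faces. $F(T)$, $E(T)$ are its sets of faces and edges. $P_j(D)$ is the space of polynomials of total degree at most $j$ on $D$ ($D$ a volume, a face or an edge). $(\cdot,\cdot)_D$ is the $L^2$ inner product on $D$ (volume, surface or curve). $\mathbf{n}$ is the unit outward normal on $\partial T$. For a face $f$, $\mathbf{n}_f$ is a fixed unit normal, $\mathbf{t}_{f,1},\mathbf{t}_{f,2}$ are orthogonal unit vectors tangential to $f$, and $\mathbf{t}$ is the unit tangent on $\partial f$ oriented by the right-hand rule with respect to $\mathbf{n}_f$. For an edge $e$, $\mathbf{t}_e$ is a fixed unit tangent vector. Generic spaces. For integer $j\ge0$ put $X_j(T)=[P_j(T)]^3$, $X_j(f)=\{u_1\mathbf{t}_{f,1}+u_2\mathbf{t}_{f,2}: u_1,u_2\in P_j(f)\}$, $X_j(e)=\{u\mathbf{t}_e: u\in P_j(e)\}$, $N_j(f)=\{w_f\mathbf{n}_f: w_f\in P_j(f)\}$. Equal-order spaces ($k\ge0$; components on different faces and edges are independent): - $V_k^{(2)}(T)=\{\mathbf{u}=\{\mathbf{u}_0,\mathbf{u}_f,\mathbf{u}_e\}: \mathbf{u}_0\in X_k(T),\mathbf{u}_f\in X_k(f),\mathbf{u}_e\in X_k(e), f\in F(T), e\in E(T)\}$, - $V_k^{(3)}(T)=\{\mathbf{w}=\{\mathbf{w}_0,\mathbf{w}_f\}: \mathbf{w}_0\in X_k(T),\mathbf{w}_f\in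 N_k(f), f\in F(T)\}$, - $V_k^{(4)}(T)=P_k(T)$. Descending-order spaces ($k\ge3$): - $W_{k-1}^{(2)}(T)=\{\{\mathbf{u}_0,\mathbf{u}_f,\mathbf{u}_e\}: \mathbf{u}_0\in X_{k-1}(T),\mathbf{u}_f\in X_{k-2}(f),\mathbf{u}_e\in X_{k-3}(e)\}$, - $W_{k-2}^{(3)}(T)=\{\{\mathbf{w}_0,\mathbf{w}_f\}: \mathbf{w}_0\in X_{k-2}(T),\mathbf{w}_f\in N_{k-3}(f)\}$, - $W_{k-3}^{(4)}(T)=P_{k-3}(T)$. Weak curl. $\nabla_w\times\mathbf{u}=\{\nabla_{w,0}\times\mathbf{u},\nabla_{w,f}\times\mathbf{u}\}$, where $\nabla_{w,0}\times\mathbf{u}\in X_a(T)$ and $\nabla_{w,f}\times\mathbf{u}\in N_b(f)$ are determined by $$(\nabla_{w,0}\times\mathbf{u},\theta)_T=(\mathbf{u}_0,\nabla\times\theta)_T+(\mathbf{u}_f,\theta\times\mathbf{n})_{\partial T}\quad\forall\theta\in X_a(T),$$ $$(\nabla_{w,f}\times\mathbf{u},\tau\mathbf{n}_f)_f=(\mathbf{u}_f,\nabla\tau\times\mathbf{n}_f)_f+(\mathbf{u}_e,\tau\mathbf{t})_{\partial f}\quad\forall\tau\mathbf{n}_f\in N_b(f),$$ with $(a,b)=(k,k)$ for $\mathbf{u}\in V_k^{(2)}(T)$ and $(a,b)=(k-2,k-3)$ for $\mathbf{u}\in W_{k-1}^{(2)}(T)$. Weak divergence. $\nabla_w\cdot\mathbf{w}\in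 P_c(T)$ is determined by $$(\nabla_w\cdot\mathbf{w},\tau)_T=-(\mathbf{w}_0,\nabla\tau)_T+(\mathbf{w}_f,\tau\mathbf{n})_{\partial T}\quad\forall\tau\in P_c(T),$$ with $c=k$ for $\mathbf{w}\in V_k^{(3)}(T)$ and $c=k-3$ for $\mathbf{w}\in W_{k-2}^{(3)}(T)$. *)

(* Defs.v *)
(* MathComp / MathComp-Analysis, over an arbitrary [R : realType].
   The notations of mpoly clash with those of MathComp-Analysis, so they are
   not imported: [mpoly n R] is the ring of polynomials in n variables and
   [msize p] is 1 + (total degree of p), with [msize 0 = 0]. *)
From HB Require Import structures.
From mathcomp Require Import all_boot all_order all_algebra.
From mathcomp Require Export -(notations) mpoly.
From mathcomp Require Import all_classical all_reals all_analysis.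

Set Implicit Arguments.
Unset Strict Implicit.
Unset Printing Implicit Defensive.

Import Order.TTheory GRing.Theory Num.Theory.
Import numFieldNormedType.Exports.
Local Open Scope classical_set_scope.
Local Open Scope ring_scope.

Section Vectors.
Variable A : comNzRingType.
Implicit Types u v : 'rV[A]_3.

Definition dot u v : A := \sum_(i < 3) u 0 i * v 0 i.

(* The indices i + 1 and i + 2 are taken modulo 3, in the ring 'I_3. *)
Definition cross u v : 'rV[A]_3 :=
  \row_(i < 3) (u 0 (i + 1) * v 0 (i + 2) - u 0 (i + 2) * v 0 (i + 1)).

Definition vec3 (a b c : A) : 'rV[A]_3 := \row_(i < 3) [:: a; b; c]`_i.

End Vectors.

Section FormalPolynomials.
Variable R : realType.

(* A polynomial on a domain that is full-dimensional in the space, a plane or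
   a line is identified with a formal polynomial in Cartesian coordinates of
   that affine space. *)
Definition Pol (n j : nat) : set (mpoly n R) := [set p | (msize p <= j.+1)%N].
Definition Pol1 (j : nat) : set {poly R} := [set p | (size p <= j.+1)%N].
Definition VecPol (j : nat) : set 'rV[mpoly 3 R]_3 :=
  [set v | forall i, Pol j (v 0 i)].

Definition grad (p : mpoly 3 R) : 'rV[mpoly 3 R]_3 := \row_(i < 3) mderiv i p.

Definition curl (v : 'rV[mpoly 3 R]_3) : 'rV[mpoly 3 R]_3 :=
  \row_(i < 3) (mderiv (i + 1) (v 0 (i + 2)) - mderiv (i + 2) (v 0 (i + 1))).

Definition peval (p : mpoly 3 R) (x : 'rV[R]_3) : R := meval (x 0) p.
Definition veval (v : 'rV[mpoly 3 R]_3) (x : 'rV[R]_3) : 'rV[R]_3 :=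
  \row_(i < 3) peval (v 0 i) x.

End FormalPolynomials.

(* A body with finite families of faces and edges, and a choice of coordinate
   frames and normal and tangent vectors. The conditions relating these data
   are in [is_polyhedron]. *)
Record polyhedral_data (R : realType) := PolyhedralData {
  body : set 'rV[R]_3;
  face : finType;
  edge : finType;
  incident : edge -> face -> bool;        (* the edge lies on the boundary of the face *)
  fset : face -> set 'rV[R]_3;            (* the closed polygon *)
  forig : face -> 'rV[R]_3;               (* a point of the plane of the face *)
  ftan : face -> 'I_2 -> 'rV[R]_3;        (* t_{f,1}, t_{f,2} *)
  fnrm : face -> 'rV[R]_3;                (* n_f *)
  nout : face -> 'rV[R]_3;                (* n, on the face *)
  eorig : edge -> 'rV[R]_3;               (* an end point *)
  etan : edge -> 'rV[R]_3;                (* t_e, pointing to the other end point *)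
  elen : edge -> R;
  btan : face -> edge -> 'rV[R]_3         (* t, on the edge e of the boundary of f *)
}.

Section Geometry.
Variables (R : realType) (T : polyhedral_data R).
Local Notation mu := (@lebesgue_measure R).

Definition fchart (f : face T) (y : R * R) : 'rV[R]_3 :=
  forig f + y.1 *: ftan f 0 + y.2 *: ftan f 1.

Definition fcoord (f : face T) (x : 'rV[R]_3) : 'I_2 -> R :=
  fun i => dot (x - forig f) (ftan f i).

Definition floc (f : face T) : set (R * R) := [set y | fset f (fchart f y)].

(* relative interior of a face *)
Definition frint (f : face T) : set 'rV[R]_3 := fchart f @` (floc f)°.

Definition echart (e : edge T) (s : R) : 'rV[R]_3 := eorig e + s *: etan e.

Definition eset (e : edge T) : set 'rV[R]_3 := echart e @` `[0, elen e].
Definition erint (e : edge T) : set 'rV[R]_3 := echart e @` `]0, elen e[.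

(* Neither the body nor the faces need be convex, simply connected or even
   connected; coplanar faces may be adjacent. *)
Record is_polyhedron : Prop := IsPolyhedron {
  body_neq0 : body T !=set0;
  body_compact : compact (body T);
  body_regular : closure (body T)° = body T;
  body_boundary : body T `\` (body T)° = \bigcup_(f in [set: face T]) fset f;

  ftan_orthonormal : forall (f : face T) i j, dot (ftan f i) (ftan f j) = (i == j)%:R;
  fnrm_unit : forall f : face T, dot (fnrm f) (fnrm f) = 1;
  fnrm_orthogonal : forall (f : face T) i, dot (fnrm f) (ftan f i) = 0;
  (* [frint f] lies in the plane of the frame, hence so does [fset f] *)
  face_neq0 : forall f : face T, frint f !=set0;
  face_regular : forall f : face T, closure (frint f) = fset f;
  face_boundary : forall f : face T,
    fset f `\` frint f = \bigcup_(e in [set e | incident e f]) eset e;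
  face_disjoint : forall f f' : face T, f != f' -> fset f `&` frint f' = set0;

  etan_unit : forall e : edge T, dot (etan e) (etan e) = 1;
  elen_gt0 : forall e : edge T, 0 < elen e;
  edge_disjoint : forall e e' : edge T, e != e' -> eset e `&` erint e' = set0;
  edge_two_faces : forall e : edge T, #|[set f | incident e f]%SET| = 2;

  (* n is the unit normal pointing out of the body *)
  nout_normal : forall f : face T, nout f = fnrm f \/ nout f = - fnrm f;
  nout_outward : forall (f : face T) x, frint f x ->
    \forall s \near 0^'+, body T (x - s *: nout f) /\ ~ body T (x + s *: nout f);

  (* right-hand rule: seen from the tip of n_f, the face is on the left of t *)
  btan_tangent : forall (f : face T) e, incident e f ->
    btan f e = etan e \/ btan f e = - etan e;
  btan_right_hand : forall (f : face T) e, incident e f -> forall x, erint e x ->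
    \forall s \near 0^'+, fset f (x + s *: cross (fnrm f) (btan f e))
}.

(* Volume, surface and curve integrals. The charts of faces and edges are
   isometric, so that no density appears. *)
Definition int_body (g : 'rV[R]_3 -> R) : R :=
  \int[((mu \x mu) \x mu)%E]_(z in [set z | body T (vec3 z.1.1 z.1.2 z.2)])
    g (vec3 z.1.1 z.1.2 z.2).

Definition int_face (f : face T) (g : 'rV[R]_3 -> R) : R :=
  \int[(mu \x mu)%E]_(y in floc f) g (fchart f y).

Definition int_edge (e : edge T) (g : 'rV[R]_3 -> R) : R :=
  \int[mu]_(s in `[0, elen e]) g (echart e s).

Definition feval (f : face T) (p : mpoly 2 R) (x : 'rV[R]_3) : R :=
  meval (fcoord f x) p.

Definition eeval (e : edge T) (p : {poly R}) (x : 'rV[R]_3) : R :=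
  p.[dot (x - eorig e) (etan e)].

(* the tangential field u_1 t_{f,1} + u_2 t_{f,2} *)
Definition ftan_field (f : face T) (u : 'I_2 -> mpoly 2 R) (x : 'rV[R]_3) :
    'rV[R]_3 :=
  \sum_(i < 2) feval f (u i) x *: ftan f i.

(* Tangential gradient; it has the same cross product with n_f as the gradient
   of any extension of p to the space. *)
Definition fgrad (f : face T) (p : mpoly 2 R) (x : 'rV[R]_3) : 'rV[R]_3 :=
  ftan_field f (fun i => mderiv i p) x.

(* {u_0, u_f, u_e}: [u2e u e] is the coefficient of t_e *)
Record field2 := Field2 {
  u2o : 'rV[mpoly 3 R]_3;
  u2f : face T -> 'I_2 -> mpoly 2 R;
  u2e : edge T -> {poly R}
}.

(* {w_0, w_f}: [w3f w f] is the coefficient of n_f *)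
Record field3 := Field3 {
  w3o : 'rV[mpoly 3 R]_3;
  w3f : face T -> mpoly 2 R
}.

Definition space2 (j0 jf je : nat) : set field2 :=
  [set u | [/\ VecPol j0 (u2o u), (forall f i, Pol jf (u2f u f i))
             & (forall e, Pol1 je (u2e u e))]].

Definition space3 (j0 jf : nat) : set field3 :=
  [set w | VecPol j0 (w3o w) /\ (forall f, Pol jf (w3f w f))].

Definition V2 (k : nat) : set field2 := space2 k k k.
Definition V3 (k : nat) : set field3 := space3 k k.
Definition V4 (k : nat) : set (mpoly 3 R) := Pol k.

(* [W2 (k - 1)], [W3 (k - 2)] and [W4 (k - 3)] are the descending-order spaces,
   for [3 <= k]; the subtractions below are then exact. *)
Definition W2 (j : nat) : set field2 := space2 j (j - 1) (j - 2).
Definition W3 (j : nat) : set field3 := space3 j (j - 1).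
Definition W4 (j : nat) : set (mpoly 3 R) := Pol j.

Definition is_weak_curl_body (a : nat) (u : field2) (w : 'rV[mpoly 3 R]_3) : Prop :=
  VecPol a w /\
  forall theta, VecPol a theta ->
    int_body (fun x => dot (veval w x) (veval theta x)) =
    int_body (fun x => dot (veval (u2o u) x) (veval (curl theta) x)) +
    \sum_(f : face T) int_face f (fun x =>
      dot (ftan_field f (u2f u f) x) (cross (veval theta x) (nout f))).

Definition is_weak_curl_face (b : nat) (u : field2) (f : face T) (w : mpoly 2 R) : Prop :=
  Pol b w /\
  forall tau, Pol b tau ->
    int_face f (fun x => dot (feval f w x *: fnrm f) (feval f tau x *: fnrm f)) =
    int_face f (fun x =>
      dot (ftan_field f (u2f u f) x) (cross (fgrad f tau x) (fnrm f))) +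
    \sum_(e : edge T | incident e f) int_edge e (fun x =>
      dot (eeval e (u2e u e) x *: etan e) (feval f tau x *: btan f e)).

Definition is_weak_curl (a b : nat) (u : field2) (w : field3) : Prop :=
  is_weak_curl_body a u (w3o w) /\ forall f, is_weak_curl_face b u f (w3f w f).

Definition is_weak_div (c : nat) (w : field3) (d : mpoly 3 R) : Prop :=
  Pol c d /\
  forall tau, Pol c tau ->
    int_body (fun x => peval d x * peval tau x) =
    - int_body (fun x => dot (veval (w3o w) x) (veval (grad tau) x)) +
    \sum_(f : face T) int_face f (fun x =>
      dot (feval f (w3f w f) x *: fnrm f) (peval tau x *: nout f)).

(* [xget 0 S] is an element of S if there is one, and 0 otherwise. *)
Definition weak_curl (a b : nat) (u : field2) : field3 :=
  Field3 (xget 0 [set w | is_weak_curl_body a u w])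
         (fun f => xget 0 [set w | is_weak_curl_face b u f w]).

Definition weak_div (c : nat) (w : field3) : mpoly 3 R :=
  xget 0 [set d | is_weak_div c w d].

End Geometry.

(* Main.v *)
(* The Gram matrix of a spanning family solves the finite-dimensional problems
   that define the weak operators: the forms are definite because a polynomial
   that vanishes on an open set is zero.

   Testing the weak divergence of a weak curl with tau, the definition of the
   weak curl applies with theta = grad tau and with the restrictions of tau to
   the faces. Since curl grad = 0 and since only the tangential gradient enters
   the cross product with the normal, all that remains is the sum over the edges
   of the integral of u_e tau, multiplied by the sum of the signs with which the
   two faces at the edge orient it. That the two signs are opposite is the
   geometric part: near an interior point of the edge, the boundary of the body
   is the union of two half-discs, and a segment in the smaller wedge between
   them does not meet it, so that both ends of the segment are on the same side
   of the boundary; equal signs would put exactly one of them in the body. *)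
Require Import Defs.
From HB Require Import structures.
From mathcomp Require Import all_boot all_order all_algebra.
From mathcomp Require Import all_classical all_reals all_analysis.
From mathcomp Require Import ring lra.
Import Order.TTheory GRing.Theory Num.Theory.
Import numFieldNormedType.Exports.
Local Open Scope classical_set_scope.
Local Open Scope ring_scope.
Set Implicit Arguments.
Unset Strict Implicit.
Unset Printing Implicit Defensive.

(** * Multivariate polynomials: induction, chain rule and vanishing *)

Lemma mpoly_alg_ind (n : nat) (A : comNzRingType) (P : mpoly n A -> Prop) :
  (forall c, P (mpolyC n c)) -> (forall i, P (mpolyX A (mnm1 i))) ->
  (forall p q, P p -> P q -> P (p + q)) ->
  (forall p q, P p -> P q -> P (p * q)) ->
  forall p, P p.
Proof.
move=> PC PX PD PM.
have P1 : P 1 by rewrite -mpolyC1; apply: PC.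
have PXn m : P (mpolyX A m).
  rewrite mpolyXE_id; elim/big_ind: _ => // i _.
  by elim: (m i) => [|k IH]; rewrite ?expr0 // exprS; apply: PM.
apply: mpolyind => [|c m p _ _ Pp]; first by rewrite -mpolyC0; apply: PC.
by apply: PD => //; rewrite -mul_mpolyC; apply: PM.
Qed.

(** In [p], both sides are derivations that agree on constants and on variables. Two instances
    occur: [D] is the univariate derivative when [p] is restricted to a line, and a partial
    derivative when [p] is restricted to a face. *)
Lemma mmap_chain_rule (n : nat) (A B : comNzRingType) (f : {rmorphism A -> B})
    (h : 'I_n -> B) (D : B -> B) :
  (forall x y, D (x + y) = D x + D y) ->
  (forall x y, D (x * y) = D x * y + x * D y) ->
  (forall c, D (f c) = 0) ->
  forall p, D (mmap f h p) = \sum_i mmap f h (mderiv i p) * D (h i).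
Proof.
move=> DD DM Df; apply: mpoly_alg_ind => [c|i|p q Hp Hq|p q Hp Hq].
- rewrite mmapC Df big1 // => i _.
  by rewrite mderivC mmap0 mul0r.
- rewrite mmapX mmap1U (bigD1 i) //= mderivX mnm1E eqxx.
  rewrite big1 => [|j jNi]; last first.
    by rewrite mderivX mnm1E eq_sym (negbTE jNi) scale0r mmap0 mul0r.
  by rewrite scale1r addr0 -{1}[mnm1 i]add0m addmK mpolyX0 rmorph1 mul1r.
- rewrite mmapD DD Hp Hq -big_split /=; apply: eq_bigr => i _.
  by rewrite mderivD mmapD mulrDl.
- rewrite rmorphM DM Hp Hq mulr_suml mulr_sumr -big_split /=.
  apply: eq_bigr => i _.
  by rewrite mderivM rmorphD !rmorphM /=; ring.
Qed.

Section VanishingPolynomials.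
Variables (n : nat) (R : realFieldType).
Implicit Types (p : mpoly n R).

Lemma poly_infinite_roots (q : {poly R}) (e : R) :
  0 < e -> (forall s, 0 < s < e -> q.[s] = 0) -> q = 0.
Proof.
move=> e0 qs; apply/eqP; apply: contraT => q0.
(* These are [size q] distinct points strictly between 0 and [e], one root more than a nonzero [q]
   can have; starting the denominators at 2 keeps them below [e]. *)
pose s := [seq e / k.+2%:R | k <- iota 0 (size q)].
have : (size s < size q)%N.
  apply: max_poly_roots => //.
    apply/allP => _ /mapP[k _ ->]; apply/eqP; apply: qs.
    by rewrite divr_gt0 //= ltr_pdivrMr // ltr_pMr // ltr1n.
  rewrite map_inj_uniq ?iota_uniq // => i j /(mulfI (lt0r_neq0 e0))/invr_inj/eqP.
  by rewrite eqr_nat => /eqP[].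
by rewrite size_map size_iota ltnn.
Qed.

Let line (a h : 'I_n -> R) : 'I_n -> {poly R} := fun i => (a i)%:P + h i *: 'X.

Lemma mmap_line p a h s :
  (mmap polyC (line a h) p).[s] = meval (fun i => a i + s * h i) p.
Proof.
elim/mpoly_alg_ind: p => [c|i|p q Hp Hq|p q Hp Hq].
- by rewrite mmapC mevalC hornerC.
- by rewrite mmapX mmap1U mevalXU /line !hornerE mulrC.
- by rewrite mmapD mevalD hornerD Hp Hq.
- by rewrite rmorphM mevalM hornerM Hp Hq.
Qed.

(** On the line from the centre [a] through [v], [p] becomes a univariate polynomial that vanishes
    for all small parameters, hence also at the parameter 1, which is [v]. *)
Lemma meval_vanish_box p (a : 'I_n -> R) (e : R) :
  0 < e -> (forall v, (forall i, `|v i - a i| < e) -> meval v p = 0) ->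
  forall v, meval v p = 0.
Proof.
move=> e0 pa v.
pose h i := v i - a i.
suff /(congr1 (fun q => q.[1])) : mmap polyC (line a h) p = 0.
  rewrite mmap_line horner0 => <-; apply: meval_eq => i.
  by rewrite mul1r /h addrC subrK.
(* [M] bounds every entry of the direction, and the added 1 keeps it positive when the direction is
   zero; parameters below [e / M] stay in the box. *)
pose M := \sum_i `|h i| + 1.
have M0 : 0 < M by rewrite ltr_wpDl // sumr_ge0.
apply: (@poly_infinite_roots _ (e / M)) => [|s /andP[s0 se]].
  exact: divr_gt0.
rewrite mmap_line; apply: pa => i.
rewrite addrC addKr normrM gtr0_norm //.
apply: (@le_lt_trans _ _ (s * M)); last by rewrite -ltr_pdivlMr.
rewrite ler_pM2l // /M (bigD1 i) //= -addrA lerDl addr_ge0 // sumr_ge0 //.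
Qed.

Lemma mcoeff0_meval p : mcoeff (@mnm0 n) p = meval (fun=> 0) p.
Proof.
elim/mpoly_alg_ind: p => [c|i|p q Hp Hq|p q Hp Hq].
- by rewrite mcoeffC eqxx mulr1 mevalC.
- by rewrite mcoeffX mnm1_eq0 mevalXU.
- by rewrite mcoeffD mevalD Hp Hq.
- by rewrite (rmorphM (mcoeff (@mnm0 n))) /= mevalM Hp Hq.
Qed.

(** The formal partial derivative is read off as the derivative at 0 of the univariate polynomial
    along the [i]-th coordinate direction, and that polynomial is zero. *)
Lemma meval_vanish_mderiv p i :
  (forall v, meval v p = 0) -> forall v, meval v (mderiv i p) = 0.
Proof.
move=> p0 v; pose h j : R := (j == i)%:R.
have q0 : mmap polyC (line v h) p = 0.
  by apply: (@poly_infinite_roots _ 1) => // s _; rewrite mmap_line p0.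
have : (mmap polyC (line v h) p)^`().[0] = 0 by rewrite q0 deriv0 horner0.
rewrite (@mmap_chain_rule _ _ _ polyC _ (@deriv R)); first last.
- exact: derivC.
- exact: derivM.
- exact: derivD.
have dl j : (line v h j)^`() = (j == i)%:R%:P.
  by rewrite /line derivD derivC derivZ derivX add0r alg_polyC.
rewrite (bigD1 i) //= big1 => [|j jNi]; last first.
  by rewrite dl (negbTE jNi) mulr0.
rewrite addr0 dl eqxx mulr1 mmap_line => <-.
by apply: meval_eq => j; rewrite mul0r addr0.
Qed.

(** Induction on the degree of the monomial [m]: if [m] contains the variable [i], its coefficient
    times a positive integer is a coefficient of lower degree in the [i]-th derivative, which
    vanishes everywhere too. The integer is invertible in [R]. *)
Lemma meval_vanish p : (forall v, meval v p = 0) -> p = 0.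
Proof.
move=> p0; apply/mpolyP => m; rewrite mcoeff0.
have [k] := ubnP (mdeg m); elim: k p p0 m => // k IH p p0 m mk.
have [->|m0] := eqVneq m (@mnm0 n); first by rewrite mcoeff0_meval p0.
have [i mi] : exists i, (0 < m i)%N.
  apply/existsP; apply: contraNT m0; rewrite negb_exists => /forallP H.
  by apply/eqP/mnmP => i; rewrite mnm0E; apply/eqP; rewrite -leqn0 leqNgt.
have Em : m = mnm_add (mnm_sub m (mnm1 i)) (mnm1 i).
  rewrite submK //; apply/mnm_lepP => j; rewrite mnm1E.
  by have [<-|] := eqVneq i j.
have mk' : (mdeg (mnm_sub m (mnm1 i)) < k)%N.
  by move: mk; rewrite {1}Em mdegD mdeg1 addn1.
have /eqP := IH _ (meval_vanish_mderiv i p0) _ mk'.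
by rewrite mcoeff_mderiv -Em -mulr_natr mulf_eq0 pnatr_eq0 orbF => /eqP.
Qed.

End VanishingPolynomials.

(** * Bounds on the total degree *)

Section PolynomialDegree.
Variable R : realType.

(** Expressed through coefficients, the degree bound is a family of linear conditions, which sums,
    scalings and derivatives visibly respect. *)
Lemma PolP (n j : nat) (p : mpoly n R) :
  Pol j p <-> forall m, (j < mdeg m)%N -> mcoeff m p = 0.
Proof.
split=> [pj m jm|H].
  by apply: memN_msupp_eq0; apply: msize_mdeg_ge; apply: leq_trans jm.
rewrite /Pol /= msizeE; apply/bigmax_leqP_seq => m mp _; rewrite ltnS leqNgt.
by apply: contraL mp => /H/eqP; rewrite mcoeff_msupp negbK.
Qed.

Lemma Pol0 n j : Pol j (0 : mpoly n R).
Proof. by apply/PolP => m _; rewrite mcoeff0. Qed.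

Lemma PolD n j (p q : mpoly n R) : Pol j p -> Pol j q -> Pol j (p + q).
Proof.
move=> /PolP Hp /PolP Hq; apply/PolP => m jm.
by rewrite mcoeffD Hp ?Hq ?addr0.
Qed.

Lemma PolZ n j c (p : mpoly n R) : Pol j p -> Pol j (c *: p).
Proof. by move=> /PolP Hp; apply/PolP => m jm; rewrite mcoeffZ Hp ?mulr0. Qed.

Lemma PolW n j j' (p : mpoly n R) : (j <= j')%N -> Pol j p -> Pol j' p.
Proof.
by move=> jj /PolP Hp; apply/PolP => m jm; rewrite Hp // (leq_ltn_trans jj).
Qed.

Lemma Pol_mderiv n j i (p : mpoly n R) : Pol j.+1 p -> Pol j (mderiv i p).
Proof.
move=> /PolP Hp; apply/PolP => m jm.
by rewrite mcoeff_mderiv Hp ?mul0rn // mdegD mdeg1 addn1.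
Qed.

Lemma PolM n j j' (p q : mpoly n R) :
  Pol j p -> Pol j' q -> Pol (j + j') (p * q).
Proof.
rewrite /Pol /= => pj qj.
have [->|p0] := eqVneq p 0; first by rewrite mul0r msize0.
have [->|q0] := eqVneq q 0; first by rewrite mulr0 msize0.
rewrite msizeM // -subn1 leq_subLR; apply: leq_trans (leq_add pj qj) _.
by rewrite addSn addnS add1n.
Qed.

Lemma PolC n c : Pol 0 (mpolyC n c : mpoly n R).
Proof.
by apply/PolP => m m0; rewrite mcoeffC; case: eqP m0 => [->|]; rewrite ?mdeg0 ?mulr0.
Qed.

Lemma PolX n m : Pol (mdeg m) (mpolyX R m : mpoly n R).
Proof. by rewrite /Pol /= msizeX. Qed.

(** Affine substitutions do not raise the degree; this makes the restriction of a test function to a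
    face an admissible test function there. *)
Lemma Pol_mmap n n' j (h : 'I_n -> mpoly n' R) (p : mpoly n R) :
  (forall i, Pol 1 (h i)) -> Pol j p -> Pol j (mmap (@mpolyC n' R) h p).
Proof.
move=> h1 pj; rewrite (mpolywE pj) raddf_sum /=.
elim/big_ind: _ => [|q r|m _]; [exact: Pol0|exact: PolD|].
rewrite mmapZ mmapX mul_mpolyC; apply: PolZ.
apply: (@PolW _ (mdeg m)); first by rewrite -ltnS bmdeg.
rewrite mdegE /mmap1; elim/big_rec2: _ => [|i k q _ IH].
  by rewrite -mpolyC1; apply: PolC.
apply: PolM => //; elim: (bmnm m i) => [|a IHa].
  by rewrite expr0 -mpolyC1; apply: PolC.
by rewrite exprS -add1n; apply: PolM.
Qed.

End PolynomialDegree.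

(** * Representation of linear forms on a finitely spanned space *)

Section Riesz.
Variable R : realFieldType.

(** A linear system is solvable as soon as its right-hand side is annihilated by the kernel of the
    matrix. The spanning family may be dependent, so the Gram matrix may be singular; vectors of its
    kernel also annihilate the quadratic form, which is how the hypothesis reaches them. *)
Lemma gram_solvable (I : finType) (G : I -> I -> R) (l : I -> R) :
  (forall c : I -> R, \sum_i \sum_j c i * c j * G i j = 0 ->
     \sum_j c j * l j = 0) ->
  exists c, forall j, \sum_i c i * G i j = l j.
Proof.
move=> H.
pose Gm : 'M[R]_#|I| := \matrix_(i, j) G (enum_val i) (enum_val j).
pose lm : 'rV[R]_#|I| := \row_j l (enum_val j).
have sumI (F : I -> R) : \sum_i F i = \sum_(i < #|I|) F (enum_val i).
  by rewrite (reindex _ (onW_bij _ (enum_val_bij I))).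
have /submxP[c Ec] : (lm <= Gm)%MS.
  rewrite submxE; apply/eqP/matrixP => i0 k; rewrite mxE [RHS]mxE.
  (* A column of the cokernel matrix is a vector that [Gm] sends to zero. *)
  pose v i := cokermx Gm (enum_rank i) k.
  rewrite -[RHS](H v).
    rewrite sumI; apply: eq_bigr => j _.
    by rewrite mxE mulrC /v enum_valK.
  rewrite big1 // => i _.
  have /matrixP/(_ (enum_rank i) k) := mulmx_coker Gm.
  rewrite mxE [RHS]mxE => E; rewrite -[RHS](mulr0 (v i)) -[X in _ = _ * X]E mulr_sumr sumI.
  by apply: eq_bigr => j _; rewrite mxE /v !(enum_valK, enum_rankK); ring.
exists (fun i => c 0 (enum_rank i)) => j.
have /matrixP/(_ 0 (enum_rank j)) := Ec; rewrite mxE enum_rankK => ->.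
by rewrite mxE sumI; apply: eq_bigr => i _; rewrite mxE enum_rankK enum_valK.
Qed.

(* [sc] is the scaling of V: the vectors below have polynomial entries, hence
   are canonically a module over the polynomials but not over R. *)
Lemma riesz_representation (V : zmodType) (sc : R -> V -> V) (S : set V)
    (I : finType) (b : I -> V) (B : V -> V -> R) (L : V -> R) :
  (forall v, S v <-> exists c, v = \sum_i sc (c i) (b i)) ->
  (forall u v w, B (u + v) w = B u w + B v w) ->
  (forall u v w, B w (u + v) = B w u + B w v) ->
  (forall a u v, B (sc a u) v = a * B u v) ->
  (forall a u v, B u (sc a v) = a * B u v) ->
  (forall u, B u u = 0 -> u = 0) ->
  (forall u v, L (u + v) = L u + L v) ->
  (forall a u, L (sc a u) = a * L u) ->
  exists w, unique (fun w => S w /\ forall v, S v -> B w v = L v) w.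
Proof.
move=> SP BDl BDr BZl BZr Bdef LD LZ.
have add0 (F : V -> R) : (forall u v, F (u + v) = F u + F v) -> F 0 = 0.
  by move=> FD; apply: (addrI (F 0)); rewrite -FD !addr0.
have sumF (F : V -> R) : (forall u v, F (u + v) = F u + F v) ->
    (forall a u, F (sc a u) = a * F u) ->
    forall c, F (\sum_i sc (c i) (b i)) = \sum_i c i * F (b i).
  move=> FD FZ c; rewrite (big_morph F FD (add0 F FD)).
  by apply: eq_bigr => i _.
have [c Hc] : exists c, forall j, \sum_i c i * B (b i) (b j) = L (b j).
  (* By definiteness, a combination on which the quadratic form vanishes is the zero vector, and [L]
     is zero there. *)
  apply: gram_solvable => c E.
  rewrite -sumF //; rewrite (Bdef (\sum_i sc (c i) (b i))); first exact: add0.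
  rewrite (sumF (fun x => B x _)) // -[RHS]E; apply: eq_bigr => i _.
  rewrite (sumF (B (b i))) // mulr_sumr; apply: eq_bigr => j _.
  by rewrite mulrA.
exists (\sum_i sc (c i) (b i)); set w := \sum_i _.
have Sw : S w by apply/SP; exists c.
have Bw v : S v -> B w v = L v.
  move=> /SP[d ->]; rewrite !sumF //; apply: eq_bigr => j _.
  by rewrite -Hc /w (sumF (fun x => B x _)).
split=> // w' [Sw' Bw']; apply/eqP; rewrite -subr_eq0; apply/eqP/Bdef.
have B0 v : S v -> B (w - w') v = 0.
  by move=> Sv; apply: (addIr (B w' v)); rewrite -BDl subrK add0r Bw // Bw'.
by apply: (addIr (B (w - w') w')); rewrite -BDr subrK !B0 // add0r.
Qed.

End Riesz.

(** * Dot and cross products in dimension three *)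

Lemma sum3E (V : nmodType) (F : 'I_3 -> V) : \sum_i F i = F 0 + F 1 + F 2.
Proof.
rewrite 3!big_ord_recr big_ord0 /= add0r.
by congr (F _ + F _ + F _); apply: val_inj.
Qed.

Section Vectors3.
Variable A : comNzRingType.
Implicit Types u v w : 'rV[A]_3.

Lemma ord3P (P : 'I_3 -> Prop) : P 0 -> P 1 -> P 2 -> forall i, P i.
Proof.
move=> P0 P1 P2 [[|[|[|//]]] Hi].
- by move: P0; congr P; apply: val_inj.
- by move: P1; congr P; apply: val_inj.
- by move: P2; congr P; apply: val_inj.
Qed.

Lemma row3P u v : u 0 0 = v 0 0 -> u 0 1 = v 0 1 -> u 0 2 = v 0 2 -> u = v.
Proof. by move=> H0 H1 H2; apply/rowP; apply: ord3P. Qed.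

Lemma dotE u v : dot u v = u 0 0 * v 0 0 + u 0 1 * v 0 1 + u 0 2 * v 0 2.
Proof. exact: sum3E. Qed.

Lemma crossE0 u v : cross u v 0 0 = u 0 1 * v 0 2 - u 0 2 * v 0 1.
Proof.
by rewrite mxE; congr (u 0 _ * v 0 _ - u 0 _ * v 0 _); apply: val_inj.
Qed.

Lemma crossE1 u v : cross u v 0 1 = u 0 2 * v 0 0 - u 0 0 * v 0 2.
Proof.
by rewrite mxE; congr (u 0 _ * v 0 _ - u 0 _ * v 0 _); apply: val_inj.
Qed.

Lemma crossE2 u v : cross u v 0 2 = u 0 0 * v 0 1 - u 0 1 * v 0 0.
Proof.
by rewrite mxE; congr (u 0 _ * v 0 _ - u 0 _ * v 0 _); apply: val_inj.
Qed.

Definition crossE := (crossE0, crossE1, crossE2).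

Lemma dotC u v : dot u v = dot v u.
Proof. by rewrite !dotE; ring. Qed.

Lemma dotDl u v w : dot (u + v) w = dot u w + dot v w.
Proof. by rewrite !dotE !mxE; ring. Qed.

Lemma dotDr u v w : dot w (u + v) = dot w u + dot w v.
Proof. by rewrite !dotE !mxE; ring. Qed.

Lemma dotZl c u v : dot (c *: u) v = c * dot u v.
Proof. by rewrite !dotE !mxE; ring. Qed.

Lemma dotZr c u v : dot u (c *: v) = c * dot u v.
Proof. by rewrite !dotE !mxE; ring. Qed.

Lemma dotNl u v : dot (- u) v = - dot u v.
Proof. by rewrite !dotE !mxE; ring. Qed.

Lemma dotNr u v : dot u (- v) = - dot u v.
Proof. by rewrite !dotE !mxE; ring. Qed.

Lemma dotBl u v w : dot (u - v) w = dot u w - dot v w.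
Proof. by rewrite dotDl dotNl. Qed.

Lemma dot0l u : dot 0 u = 0.
Proof. by rewrite !dotE !mxE; ring. Qed.

Lemma dot0r u : dot u 0 = 0.
Proof. by rewrite dotC dot0l. Qed.

Lemma crossDl u v w : cross (u + v) w = cross u w + cross v w.
Proof. by apply: row3P; rewrite [RHS]mxE !crossE !mxE; ring. Qed.

Lemma crossZl c u v : cross (c *: u) v = c *: cross u v.
Proof. by apply: row3P; rewrite [RHS]mxE !crossE !mxE; ring. Qed.

Lemma crossZr c u v : cross u (c *: v) = c *: cross u v.
Proof. by apply: row3P; rewrite [RHS]mxE !crossE !mxE; ring. Qed.

Lemma crossNr u v : cross u (- v) = - cross u v.
Proof. by rewrite -scaleN1r crossZr scaleN1r. Qed.

Lemma crossuu u : cross u u = 0.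
Proof. by apply: row3P; rewrite [RHS]mxE !crossE; ring. Qed.

Lemma dot_crossl u v : dot u (cross u v) = 0.
Proof. by rewrite dotE !crossE; ring. Qed.

Lemma dot_crossr u v : dot v (cross u v) = 0.
Proof. by rewrite dotE !crossE; ring. Qed.

Lemma cross_cross u v w : cross u (cross v w) = dot u w *: v - dot u v *: w.
Proof. by apply: row3P; rewrite !crossE !dotE !mxE; ring. Qed.

Lemma dot_cross_cross u v w x :
  dot (cross u v) (cross w x) = dot u w * dot v x - dot u x * dot v w.
Proof. by rewrite !dotE !crossE; ring. Qed.

End Vectors3.

(** The matrix [Q] with rows [a], [b], [c] has its transpose as right inverse, hence also as left
    inverse, and the expansion is [v] times the product of the transpose with [Q]. *)
Lemma orthonormal_expand (A : comUnitRingType) (a b c v : 'rV[A]_3) :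
  dot a a = 1 -> dot b b = 1 -> dot c c = 1 ->
  dot a b = 0 -> dot a c = 0 -> dot b c = 0 ->
  v = dot v a *: a + dot v b *: b + dot v c *: c.
Proof.
move=> aa bb cc ab ac bc.
pose Q : 'M[A]_3 := \matrix_i [:: a; b; c]`_i.
have Qr : [/\ row 0 Q = a, row 1 Q = b & row 2 Q = c] by rewrite !rowK.
have QQ : Q *m Q^T = 1%:M.
  apply/matrixP => i j.
  have -> : (Q *m Q^T) i j = dot (row i Q) (row j Q).
    by rewrite mxE; apply: eq_bigr => k _; rewrite !mxE.
  rewrite [RHS]mxE; case: Qr => r0 r1 r2.
  elim/ord3P: i; elim/ord3P: j; rewrite ?(r0, r1, r2) ?(aa,bb,cc,ab,ac,bc) //.
  - by rewrite dotC.
  - by rewrite dotC.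
  - by rewrite dotC.
rewrite -[LHS]mulmx1 -(mulmx1C QQ) mulmxA.
rewrite mulmx_sum_row sum3E; case: Qr => -> -> ->.
have E i : (v *m Q^T) 0 i = dot v (row i Q).
  by rewrite mxE; apply: eq_bigr => k _; rewrite !mxE.
by rewrite !E !rowK.
Qed.

(** * Continuity and connectedness of segments *)

Section Continuity.
Variable R : realType.

Lemma continuous_dot (X : topologicalType) (F G : X -> 'rV[R]_3) :
  (forall i, continuous (fun x => F x 0 i)) ->
  (forall i, continuous (fun x => G x 0 i)) ->
  continuous (fun x => dot (F x) (G x)).
Proof.
move=> cF cG; have -> : (fun x => dot (F x) (G x)) =
    (fun x => F x 0 0 * G x 0 0 + F x 0 1 * G x 0 1 + F x 0 2 * G x 0 2).
  by apply/funext => x; rewrite dotE.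
move=> x; apply: cvgD; [apply: cvgD|].
- by apply: cvgM; [apply: cF|apply: cG].
- by apply: cvgM; [apply: cF|apply: cG].
- by apply: cvgM; [apply: cF|apply: cG].
Qed.

Lemma continuous_entry (i : 'I_3) : continuous (fun x : 'rV[R]_3 => x 0 i).
Proof. exact: coord_continuous. Qed.

Lemma continuous_rowD (X : topologicalType) (F G : X -> 'rV[R]_3) :
  (forall i, continuous (fun x => F x 0 i)) ->
  (forall i, continuous (fun x => G x 0 i)) ->
  forall i, continuous (fun x => (F x + G x) 0 i).
Proof.
move=> cF cG i; have -> : (fun x => (F x + G x) 0 i) = (fun x => F x 0 i + G x 0 i).
  by apply/funext => x; rewrite mxE.
by move=> x; apply: cvgD; [apply: cF|apply: cG].
Qed.

(** Along a segment that avoids the boundary, lying in [S] is the same as lying in its interior, so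
    it is a condition both closed and open on the connected interval of parameters. *)
Lemma segment_avoiding_boundary (V : normedModType R) (S : set V) (a b : V) :
  closed S ->
  (forall l : R, 0 <= l <= 1 -> ~ (S `\` S°) ((1 - l) *: a + l *: b)) ->
  S a -> S b.
Proof.
move=> cS bd Sa; pose g (l : R) : V := (1 - l) *: a + l *: b.
have cg : continuous g.
  move=> l; apply: cvgD; apply: cvgZr_tmp.
    by apply: cvgB; [exact: cvg_cst|exact: cvg_id].
  exact: cvg_id.
pose I : set R := `[0, 1]%classic.
have IS : I `&` g @^-1` S = I `&` g @^-1` S°.
  apply/seteqP; split => l [Il Sl]; split => //; last exact: interior_subset Sl.
  apply: contrapT => nSl; apply: (bd l); last by split.
  by move: Il; rewrite /I /= in_itv.
have := @segment_connected R 0 1 (I `&` g @^-1` S) _ _ _.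
have IE : I 1 by rewrite /I /= in_itv /= ler01 lexx.
have g0 : g 0 = a by rewrite /g subr0 scale1r scale0r addr0.
have g1 : g 1 = b by rewrite /g subrr scale1r scale0r add0r.
move=> H; suff : (I `&` g @^-1` S) 1 by case=> _; rewrite /preimage /= g1.
rewrite H //.
- by exists 0; split; rewrite /preimage /= ?g0 // /I /= in_itv /= ler01 lexx.
- exists (g @^-1` S°) => //; apply: open_comp; last exact: open_interior.
  by move=> l _; exact: cg.
- by exists (g @^-1` S) => //; apply: preimage_closed.
Qed.

(** The norm of row vectors is the largest absolute value of an entry, hence at most the Euclidean
    norm. *)
Lemma unit_vector_norm (m : 'rV[R]_3) : dot m m = 1 -> `|m| <= 1.
Proof.
move=> mm; have [->|m0] := eqVneq m 0; first by rewrite normr0 ler01.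
have n0 : mx_norm m != 0 by rewrite -[mx_norm m]/`|m| normr_eq0.
have [[i j] /=] := mx_norm_neq0 n0; rewrite -[mx_norm m]/`|m| ord1 => ->.
rewrite -(@expr_le1 _ 2) ?normr_ge0 // real_normK ?num_real // -mm /dot (bigD1 j) //= -expr2.
by rewrite lerDl sumr_ge0 // => k _; rewrite -expr2 sqr_ge0.
Qed.

End Continuity.

(** * Faces and edges of the polyhedron *)

Section PolyhedronGeometry.
Variables (R : realType) (T : polyhedral_data R).
Hypothesis hT : is_polyhedron T.

Lemma body_closed : closed (body T).
Proof. by rewrite -(body_regular hT); exact: closed_closure. Qed.

Lemma fset_closed (f : face T) : closed (fset f).
Proof. by rewrite -(face_regular hT); exact: closed_closure. Qed.

Lemma frint_fset (f : face T) : frint f `<=` fset f.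
Proof. by move=> _ [y fy <-]; exact: (interior_subset fy). Qed.

Lemma fset_body (f : face T) : fset f `<=` body T.
Proof.
move=> x fx; have : (\bigcup_(f in [set: face T]) fset f) x by exists f.
by rewrite -(body_boundary hT) => -[].
Qed.

Lemma continuous_echart (e : edge T) : continuous (echart e).
Proof.
move=> s; apply: cvgD; first exact: cvg_cst.
by apply: cvgZr_tmp; exact: cvg_id.
Qed.

Lemma eset_closed (e : edge T) : closed (eset e).
Proof.
apply: compact_closed; first exact: norm_hausdorff.
apply: continuous_compact; last exact: segment_compact.
exact/continuous_subspaceT/continuous_echart.
Qed.

Lemma erint_eset (e : edge T) : erint e `<=` eset e.
Proof.
move=> y [s]; rewrite /= in_itv /= => /andP[s0 sl] <-.
by exists s; rewrite //= in_itv /= !ltW.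
Qed.

Lemma eset_fset (e : edge T) (f : face T) : incident e f -> eset e `<=` fset f.
Proof.
move=> ef x ex; suff : (fset f `\` frint f) x by case.
by rewrite (face_boundary hT); exists e.
Qed.

Lemma fchart_sub (f : face T) y :
  fchart f y - forig f = y.1 *: ftan f 0 + y.2 *: ftan f 1.
Proof. by apply: row3P; rewrite /fchart !mxE; ring. Qed.

(** The plane is closed and contains the relative interior of the face, whose closure is the
    face. *)
Lemma fset_plane (f : face T) x : fset f x -> dot (x - forig f) (fnrm f) = 0.
Proof.
have cl : closed [set x | dot (x - forig f) (fnrm f) = 0].
  have c : continuous (fun x : 'rV[R]_3 => dot (x - forig f) (fnrm f)).
    apply: continuous_dot => [|i]; last exact: cst_continuous.
    apply: (@continuous_rowD _ _ id (fun=> - forig f)).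
      exact: continuous_entry.
    by move=> i; exact: cst_continuous.
  have -> : [set x | dot (x - forig f) (fnrm f) = 0] =
      (fun x => dot (x - forig f) (fnrm f)) @^-1` [set 0] by [].
  by apply: preimage_closed; [move=> ? _; exact: c|exact: closed_eq].
rewrite -(face_regular hT) => fx; have := closureS _ fx.
move=> /(_ [set x | dot (x - forig f) (fnrm f) = 0]).
rewrite -(closure_id _).1 //; apply=> _ [y fy <-] /=.
rewrite fchart_sub dotDl !dotZl ![dot (ftan _ _) _]dotC.
by rewrite !(fnrm_orthogonal hT) !mulr0 addr0.
Qed.

Lemma etan_fnrm (e : edge T) (f : face T) :
  incident e f -> dot (etan e) (fnrm f) = 0.
Proof.
move=> ef; have l0 := elen_gt0 hT e.
have H s : 0 <= s <= elen e -> dot (echart e s - forig f) (fnrm f) = 0.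
  by move=> sl; apply: fset_plane; apply: (eset_fset ef); exists s; rewrite //= in_itv.
have H0 : dot (eorig e - forig f) (fnrm f) = 0.
  by rewrite -(H 0) ?lexx ?ltW // /echart scale0r addr0.
have := H (elen e); rewrite ltW // lexx => /(_ isT).
rewrite /echart addrAC dotDl H0 add0r dotZl => /eqP.
by rewrite mulf_eq0 gt_eqF //= => /eqP.
Qed.

Lemma fset_sub_fnrm (f : face T) x y :
  fset f x -> fset f y -> dot (x - y) (fnrm f) = 0.
Proof.
move=> /fset_plane Hx /fset_plane Hy.
have -> : x - y = (x - forig f) - (y - forig f) by rewrite opprB addrA subrK.
by rewrite dotBl Hx Hy subrr.
Qed.

(** The point [x] also lies on a face [f1] incident to [e]. If [f1] differs from [f], then [x] is
    not in the relative interior of [f], since distinct faces do not meet there; hence it lies on an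
    edge of [f], and this edge is [e] because no other edge meets the interior of [e]. *)
Lemma incident_of_erint (e : edge T) (f : face T) x :
  erint e x -> fset f x -> incident e f.
Proof.
move=> ex fx.
have [f1 ef1] : exists f1, incident e f1.
  have /card_gt0P[f1] : (0 < #|[set f | incident e f]%SET|)%N.
    by rewrite (edge_two_faces hT).
  by rewrite inE; exists f1.
apply: contrapT => nef.
have [f1f|f1f] := eqVneq f1 f; first by apply: nef; rewrite -f1f.
have nfx : ~ frint f x.
  move=> fix_; have : (fset f1 `&` frint f) x.
    by split=> //; apply: (eset_fset ef1); exact: erint_eset.
  by rewrite (face_disjoint hT).
have : (fset f `\` frint f) x by [].
rewrite (face_boundary hT) => -[e' /= e'f e'x].
have e'e : e' != e by apply/eqP => E; apply: nef; rewrite -E.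
have : (eset e' `&` erint e) x by [].
by rewrite (edge_disjoint hT).
Qed.

(** * The boundary near an interior point of an edge *)

Section Edge.
Variables (e : edge T) (x : 'rV[R]_3).
Hypothesis ex : erint e x.

(** The faces are finitely many and closed, so those that miss [x] miss a whole neighbourhood of it;
    those through [x] are incident to [e]. *)
Lemma near_incident :
  \forall y \near x, forall f : face T, fset f y -> incident e f.
Proof.
apply: (@filter_forall _ _ _ (nbhs x)) => f.
have [ef|/negP nef] := boolP (incident e f); first exact: nearW.
have nfx : (~` fset f) x by move=> fx; apply: nef; exact: incident_of_erint fx.
have : nbhs x (~` fset f).
  by apply: open_nbhs_nbhs; split=> //; apply: closed_openC; exact: fset_closed.
by apply: filterS => y nfy fy.
Qed.

Lemma near_edge : \forall y \near x, forall e' : edge T, eset e' y -> e' = e.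
Proof.
apply: (@filter_forall _ _ _ (nbhs x)) => e'.
have [->|e'e] := eqVneq e' e; first exact: nearW.
have nx : (~` eset e') x.
  move=> e'x; have : (eset e' `&` erint e) x by [].
  by rewrite (edge_disjoint hT).
have : nbhs x (~` eset e').
  by apply: open_nbhs_nbhs; split=> //; apply: closed_openC; exact: eset_closed.
by apply: filterS => y ne'y e'y.
Qed.

Lemma cvg_ray (m : 'rV[R]_3) : x + s *: m @[s --> 0^'+] --> x.
Proof.
rewrite -[X in _ --> X]addr0; apply: cvgD; first exact: cvg_cst.
rewrite -(scale0r m); apply: cvgZr_tmp.
exact: (@cvg_at_right_filter _ _ id).
Qed.

(* The unit vector at the edge pointing into the face, and its image under the
   quarter turn about the edge. *)
Definition conormal (f : face T) : 'rV[R]_3 := cross (fnrm f) (btan f e).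
Definition turned (f : face T) : 'rV[R]_3 := cross (etan e) (conormal f).

Section Incident.
Variable f : face T.
Hypothesis ef : incident e f.
Let n := fnrm f.
Let t := etan e.

Let tt : dot t t = 1. Proof. exact: (etan_unit hT). Qed.
Let nn : dot n n = 1. Proof. exact: (fnrm_unit hT). Qed.
Let tn : dot t n = 0. Proof. exact: etan_fnrm. Qed.
Let nt : dot n t = 0. Proof. by rewrite dotC. Qed.

Lemma conormal_unit : dot (conormal f) (conormal f) = 1.
Proof.
rewrite /conormal dot_cross_cross -/n nn.
by case: (btan_tangent hT ef) => ->;
  rewrite ?(dotNl, dotNr) -/t tt ?nt ?tn; ring.
Qed.

Lemma conormal_edge : dot (conormal f) t = 0.
Proof.
rewrite /conormal dotC; case: (btan_tangent hT ef) => ->.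
  exact: dot_crossr.
by rewrite crossNr dotNr dot_crossr oppr0.
Qed.

Lemma turned_unit : dot (turned f) (turned f) = 1.
Proof.
by rewrite /turned dot_cross_cross -/t tt conormal_unit conormal_edge mulr0 mul1r subr0.
Qed.

Lemma turned_fnrm : turned f = n \/ turned f = - n.
Proof.
rewrite /turned /conormal; case: (btan_tangent hT ef) => ->.
  by left; rewrite cross_cross -/t -/n tt tn scale1r scale0r subr0.
by right; rewrite crossNr crossNr cross_cross -/t -/n tt tn scale1r scale0r subr0.
Qed.

(** The product of the two signs is the coefficient with which the face enters [edge_orientation].
    It is tied here to the side of the face, seen from the edge, on which the outward normal
    points. *)
Lemma turned_nout :
  (nout f = turned f /\ dot (nout f) n * dot t (btan f e) = 1) \/
  (nout f = - turned f /\ dot (nout f) n * dot t (btan f e) = -1).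
Proof.
have tE : cross t (cross n t) = n.
  by rewrite cross_cross tt tn scale1r scale0r subr0.
rewrite /turned /conormal -/n -/t.
case: (nout_normal hT f) => ->; case: (btan_tangent hT ef) => ->;
  rewrite -/n -/t ?crossNr tE ?(dotNl, dotNr) nn tt;
  rewrite ?opprK; [left|right|right|left]; split; rewrite //; ring.
Qed.

(** The right-hand rule only puts these points in the closed face. Near [x] the only edge that could
    contain them is [e], and moving along the conormal leaves the line of [e]. *)
Lemma frint_near_edge :
  \forall s \near 0^'+, frint f (x + s *: conormal f).
Proof.
have H := btan_right_hand hT ef ex.
have E := cvg_ray (conormal f) near_edge.
near=> s.
have s0 : 0 < s by near: s; exact: nbhs_right_gt.
apply: contrapT => nfr.
have : (fset f `\` frint f) (x + s *: conormal f) by split=> //; near: s.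
rewrite (face_boundary hT) => -[e' /= e'f e'x].
have e'e : e' = e by move: e' {e'f} e'x; near: s; exact: E.
case: e'x ex => s' _; rewrite e'e => Es [s'' _ Ex].
have : dot (x + s *: conormal f) (conormal f) = dot x (conormal f).
  rewrite -Es -Ex /echart !dotDl !dotZl -/t ![dot t _]dotC conormal_edge.
  by rewrite !mulr0.
rewrite dotDl dotZl conormal_unit mulr1 => /eqP.
by rewrite -subr_eq0 addrAC subrr add0r gt_eqF.
Unshelve. all: by end_near. Qed.

End Incident.

Section TwoFaces.
Variables f1 f2 : face T.
Hypotheses (ef1 : incident e f1) (ef2 : incident e f2) (f12 : f1 != f2).
Hypothesis only12 : forall f, incident e f -> f = f1 \/ f = f2.
Let m1 := conormal f1.
Let m2 := conormal f2.
Let p1 := turned f1.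
Let p2 := turned f2.

(** With a common conormal the two faces would overlap in their relative interiors. *)
Lemma conormal_neq : m1 <> m2.
Proof.
move=> E; have H1 := frint_near_edge ef1; have H2 := frint_near_edge ef2.
have [s [Hs1 Hs2]] : exists s, frint f1 (x + s *: m1) /\ frint f2 (x + s *: m2).
  by apply: filter_ex (filterI H1 H2).
have : (fset f1 `&` frint f2) (x + s *: m2).
  by split=> //; rewrite -E; exact: frint_fset.
by rewrite (face_disjoint hT).
Qed.

(* The segment from near face 1 to near face 2 stays on the positive side of
   the plane of face 1 and on the negative side of the plane of face 2: the
   wedge between them has an angle of at most pi. *)
Lemma sector_same_side : 0 <= dot m2 p1 ->
  \forall r \near 0^'+, \forall s \near 0^'+,
    body T (x + r *: m1 + s *: p1) <-> body T (x + r *: m2 - s *: p2).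
Proof.
move=> b0.
have a1 : dot m2 m1 <= 1.
  have : 0 <= dot (m1 - m2) (m1 - m2) by apply: sumr_ge0 => i _; rewrite -expr2 sqr_ge0.
  rewrite dotBl !dotDr !dotNr !conormal_unit // [dot (conormal f1) _]dotC -/m1 -/m2.
  by lra.
(* If [dot m2 p1] vanishes, the half-discs are coplanar and [m2] is [m1] or [- m1]; the first is
   excluded by [conormal_neq], so the wedge is a straight angle. *)
have ab : 0 < dot m2 p1 \/ dot m2 p1 = 0 /\ dot m2 m1 = -1.
  have [bE|b_neq] := eqVneq (dot m2 p1) 0; last by left; rewrite lt_def b_neq.
  right; split=> //.
  have E : m2 = dot m2 m1 *: m1.
    rewrite [LHS](@orthonormal_expand _ (etan e) m1 p1) ?conormal_unit ?turned_unit
      ?(etan_unit hT) ?bE ?conormal_edge // ?scale0r ?add0r ?addr0 //.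
    - by rewrite dotC conormal_edge.
    - by rewrite dot_crossl.
    - by rewrite dot_crossr.
  have : dot m2 m1 ^+ 2 = 1 ^+ 2.
    by rewrite expr1n -(conormal_unit ef2) -/m2 {2 3}E dotZl dotZr conormal_unit // mulr1 expr2.
  move/eqP; rewrite eqf_sqr => /orP[]/eqP // aE.
  by case: conormal_neq; rewrite E aE scale1r.
have small : \forall y \near x, forall f, fset f y -> f = f1 \/ f = f2.
  by apply: filterS near_incident => y Hy f /Hy; exact: only12.
(* In this ball only the two faces carry boundary points of the body; the whole segment stays within
   [r + s] of [x], which is taken less than [d]. *)
have /nbhs_ballP[d /= d0 Hd] := small.
near=> r.
have r0 : 0 < r by near: r; exact: nbhs_right_gt.
(* This quantity is the height above the plane of face 1 of the end point near face 2, and the depth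
   below the plane of face 2 of the other end point. It is positive for [s] small compared with [r],
   and equals [s] when the wedge is straight. *)
have Hc : \forall s \near 0^'+, 0 < s -> 0 < r * dot m2 p1 - s * dot m2 m1.
  case: ab => [b1|[-> ->]].
    have : \forall s \near 0^'+, s < r * dot m2 p1.
      by apply: nbhs_right_lt; exact: mulr_gt0.
    apply: filterS => s sr s0.
    by rewrite subr_gt0 (@le_lt_trans _ _ s) // ler_piMr // ltW.
  by apply: nearW => s s0; rewrite mulr0 sub0r mulrN1 opprK.
near=> s.
have s0 : 0 < s by near: s; exact: nbhs_right_gt.
have rs : r + s < d.
  rewrite (splitr d); apply: ltrD; first by near: r; apply: nbhs_right_lt; rewrite divr_gt0.
  by near: s; apply: nbhs_right_lt; rewrite divr_gt0.
have c0 : 0 < r * dot m2 p1 - s * dot m2 m1.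
  by move: (s0); near: s; exact: Hc.
have m1p2 : dot m1 p2 = - dot m2 p1.
  by rewrite /p2 /p1 /turned -/m1 -/m2 !dotE !crossE; ring.
have p12 : dot p2 p1 = dot m2 m1.
  by rewrite /p1 /p2 /turned dot_cross_cross (etan_unit hT) !conormal_edge // mulr0 subr0 mul1r.
pose q l := (1 - l) *: (x + r *: m1 + s *: p1) + l *: (x + r *: m2 - s *: p2).
have qx l : q l - x = (1 - l) *: (r *: m1 + s *: p1) + l *: (r *: m2 - s *: p2).
  by apply: row3P; rewrite /q !mxE; ring.
have avoid l : 0 <= l <= 1 -> ~ (body T `\` (body T)°) (q l).
  move=> /andP[l0 l1]; rewrite (body_boundary hT) => -[f _ fq].
  have qd : ball x d (q l).
    rewrite -ball_normE /= distrC qx.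
    apply: le_lt_trans rs.
    have -> : r + s = (1 - l) * (r + s) + l * (r + s) by ring.
    have N (a b : 'rV[R]_3) : dot a a = 1 -> dot b b = 1 -> `|r *: a + s *: b| <= r + s.
      move=> /unit_vector_norm na /unit_vector_norm nb.
      rewrite (le_trans (ler_normD _ _)) // !normrZ !gtr0_norm //.
      by rewrite lerD // ler_piMr // ltW.
    rewrite (le_trans (ler_normD _ _)) // !normrZ !ger0_norm ?subr_ge0 //.
    rewrite lerD // ler_wpM2l ?subr_ge0 //; first by apply: N; rewrite ?conormal_unit ?turned_unit.
    by rewrite -scalerN N // ?conormal_unit // dotNl dotNr opprK turned_unit.
  have fx f' : incident e f' -> fset f' x.
    by move=> ef'; apply: (eset_fset ef'); exact: erint_eset.
  have [ff|ff] := Hd _ qd _ fq; move: fq; rewrite ff => fq.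
  (* On face 1 the component along [p1] is zero, yet it is a convex combination of the positive
     heights of the two end points. *)
  - have : dot (q l - x) p1 = 0.
      have := fset_sub_fnrm fq (fx _ ef1).
      by rewrite /p1; case: (turned_fnrm ef1) => -> //; rewrite dotNr => ->; rewrite oppr0.
    rewrite qx dotDl !dotZl !dotDl dotNl !dotZl p12 dot_crossr turned_unit // => E.
    suff : 0 < (1 - l) * s + l * (r * dot m2 p1 - s * dot m2 m1).
      by rewrite [X in 0 < X -> _](_ : _ = 0) ?ltxx // -[RHS]E; ring.
    have [->|l_neq] := eqVneq l 0; first by lra.
    have lp : 0 < l by rewrite lt_def l_neq.
    by rewrite ltr_wpDl ?mulr_gt0 // mulr_ge0 ?subr_ge0 // ltW.
  (* On face 2 the component along [p2] is zero, yet it is the opposite of a convex combination of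
     positive depths. *)
  - have : dot (q l - x) p2 = 0.
      have := fset_sub_fnrm fq (fx _ ef2).
      by rewrite /p2; case: (turned_fnrm ef2) => -> //; rewrite dotNr => ->; rewrite oppr0.
    rewrite qx dotDl !dotZl !dotDl dotNl !dotZl m1p2 [dot p1 p2]dotC p12 dot_crossr
      turned_unit // => E.
    suff : 0 < (1 - l) * (r * dot m2 p1 - s * dot m2 m1) + l * s.
      by rewrite [X in 0 < X -> _](_ : _ = 0) ?ltxx // -oppr0 -[X in _ = - X]E; ring.
    have [->|l_neq] := eqVneq l 0; first by lra.
    have lp : 0 < l by rewrite lt_def l_neq.
    by rewrite ltr_wpDl ?mulr_gt0 // mulr_ge0 ?(ltW c0) ?subr_ge0.
split; first exact: (segment_avoiding_boundary body_closed avoid).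
apply: (segment_avoiding_boundary body_closed) => l /andP[l0 l1].
have -> : (1 - l) *: (x + r *: m2 - s *: p2) + l *: (x + r *: m1 + s *: p1) = q (1 - l).
  by rewrite /q subKr [RHS]addrC.
by apply: avoid; rewrite subr_ge0 l1 lerBlDr lerDl.
Unshelve. all: by end_near. Qed.

(** With a common sign [s], exactly one end of the segment of [sector_same_side] is displaced along
    an outward normal, so one end is in the body and the other is not. *)
Lemma nout_opposite_turn (s : R) : 0 <= dot m2 p1 ->
  nout f1 = s *: p1 -> nout f2 = s *: p2 -> s = 1 \/ s = -1 -> False.
Proof.
move=> b0 n1 n2 s1.
have H := sector_same_side b0.
have [r [Hr [Fr1 Fr2]]] : exists r,
    (\forall s \near 0^'+,
      body T (x + r *: m1 + s *: p1) <-> body T (x + r *: m2 - s *: p2)) /\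
    (frint f1 (x + r *: m1) /\ frint f2 (x + r *: m2)).
  exact: filter_ex (filterI H (filterI (frint_near_edge ef1) (frint_near_edge ef2))).
have [d [[E [B1 NB1]] [B2 NB2]]] :=
  filter_ex (filterI (filterI Hr (nout_outward hT Fr1)) (nout_outward hT Fr2)).
rewrite n1 in B1 NB1; rewrite n2 in B2 NB2.
case: s1 => sE; rewrite {}sE in B1 NB1 B2 NB2.
  by rewrite !scale1r in NB1 B2; apply: NB1; apply/E.
by move: B1 NB2; rewrite !scaleN1r !scalerN opprK => /E.
Qed.

End TwoFaces.

End Edge.

(** Each of the two incident faces contributes a sign, and the signs are opposite. As they are
    constant along the edge, the midpoint suffices to compare them. *)
Lemma edge_orientation (e : edge T) :
  \sum_(f : face T | incident e f)
    dot (nout f) (fnrm f) * dot (etan e) (btan f e) = 0.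
Proof.
have l0 := elen_gt0 hT e.
have ex : erint e (echart e (elen e / 2)).
  by exists (elen e / 2) => //=; rewrite in_itv /=; lra.
have /eqP/cards2P[f1 [f2 [f12 E]]] := edge_two_faces hT e.
have inc f : incident e f = (f == f1) || (f == f2).
  by move/setP/(_ f): E; rewrite !inE.
have ef1 : incident e f1 by rewrite inc eqxx.
have ef2 : incident e f2 by rewrite inc eqxx orbT.
have only f : incident e f -> f = f1 \/ f = f2.
  by rewrite inc => /orP[]/eqP; [left|right].
have only' f : incident e f -> f = f2 \/ f = f1 by move=> /only[]; [right|left].
have f21 : f2 != f1 by rewrite eq_sym.
have nosame s : s = 1 \/ s = -1 ->
    nout f1 = s *: turned e f1 -> nout f2 = s *: turned e f2 -> False.
  move=> s1 n1 n2.
  (* Exchanging the two faces changes the sign of this product, so one of the two orders designates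
     the wedge of angle at most pi. *)
  have [b0|b0] := leP 0 (dot (conormal e f2) (turned e f1)).
    exact: (nout_opposite_turn ex ef1 ef2 f12 only b0 n1 n2 s1).
  apply: (nout_opposite_turn ex ef2 ef1 f21 only' _ n2 n1 s1).
  suff -> : dot (conormal e f1) (turned e f2) = - dot (conormal e f2) (turned e f1).
    by rewrite oppr_ge0 ltW.
  by rewrite /turned !dotE !crossE; ring.
rewrite (bigD1 f1) //= (bigD1 f2) /=; last by rewrite ef2.
rewrite big1 ?addr0; last first.
  by move=> f /andP[/andP[]]; rewrite inc => /orP[]/eqP->; rewrite eqxx.
have [[n1 ->]|[n1 ->]] := turned_nout ef1; have [[n2 ->]|[n2 ->]] := turned_nout ef2.
- by case: (nosame 1); [left|rewrite scale1r|rewrite scale1r].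
- by rewrite subrr.
- by rewrite addNr.
- by case: (nosame (-1)); [right|rewrite scaleN1r|rewrite scaleN1r].
Qed.

End PolyhedronGeometry.

(* A countable base of the topology [nb] by measurable sets of positive
   measure. The topology is given by its neighbourhoods because the measurable
   type structure on [R] is carried by an alias of [R]. *)
Definition positive_base (R : realType) d (X : measurableType d)
    (m : set X -> \bar R) (nb : X -> set_system X) : Prop :=
  exists (I : countType) (B : I -> set X), (forall i, measurable (B i)) /\
    forall x U, nb x U -> exists i, [/\ B i x, B i `<=` U & (0 < m (B i))%E].

(** * Measurability of open sets and measure of bounded sets *)

Section ContinuousIntegrals.
Variable R : realType.
Local Notation mu := (@lebesgue_measure R).

(** The set [U] is the countable union of the base sets that it contains. This gives the
    measurability of open sets for the product measurable structures. *)
Lemma positive_base_measurable d (X : measurableType d) (m : set X -> \bar R)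
    (nb : X -> set_system X) (U : set X) :
  positive_base m nb -> (forall x, U x -> nb x U) -> measurable U.
Proof.
move=> [I [B [mB HB]]] oU.
have -> : U = \bigcup_(i in setT) (if `[< B i `<=` U >] then B i else set0).
  apply/seteqP; split => [x /[dup] Ux /oU /HB[i [Bx BU _]]|x [i _]].
    by exists i => //; case: asboolP.
  by case: asboolP => // BU; exact: BU.
apply: countable_bigcupT_measurable => // i.
by case: asboolP => // _; exact: measurable0.
Qed.

Lemma rat_interval_nbhs (x : R) (U : set R) : nbhs x U ->
  exists q : rat * rat, [/\ `]ratr q.1, ratr q.2[%classic x,
    `]ratr q.1, ratr q.2[%classic `<=` U & (0 < mu `]ratr q.1, ratr q.2[%classic)%E].
Proof.
move=> /nbhs_ballP[e /= e0 xU].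
have [p] : exists p : rat, ratr p \in `]x - e, x[.
  by apply: rat_in_itvoo; rewrite ltrBlDr ltrDl.
have [q] : exists q : rat, ratr q \in `]x, x + e[.
  by apply: rat_in_itvoo; rewrite ltrDl.
rewrite !in_itv /= => /andP[xq qe] /andP[ep px].
exists (p, q); split=> /=.
- by rewrite in_itv /= px xq.
- move=> y /=; rewrite in_itv /= => /andP[py yq]; apply: xU.
  by rewrite -ball_normE /= ltr_norml; apply/andP; split; lra.
- have pq : ratr p < ratr q :> R by apply: lt_trans xq.
  by rewrite lebesgue_measure_itv /= lte_fin pq -EFinB lte_fin subr_gt0.
Qed.

Lemma positive_base_real :
  positive_base mu (fun x : measurableTypeR R => nbhs (x : R)).
Proof.
exists (rat * rat)%type, (fun q => `]ratr q.1, ratr q.2[%classic); split => [i|].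
  exact: measurable_itv.
exact: rat_interval_nbhs.
Qed.

Lemma positive_base_prod d1 d2 (X : measurableType d1) (Y : measurableType d2)
    (m1 : {measure set X -> \bar R})
    (m2 : {sigma_finite_measure set Y -> \bar R})
    (nb1 : X -> set_system X) (nb2 : Y -> set_system Y) :
  positive_base m1 nb1 -> positive_base m2 nb2 ->
  positive_base (m1 \x m2)%E (fun z => filter_prod (nb1 z.1) (nb2 z.2)).
Proof.
move=> [I [B [mB HB]]] [J [C [mC HC]]].
exists (I * J)%type, (fun k => B k.1 `*` C k.2); split => [k|[x y] U].
  exact: measurableX.
case=> -[P Q] /= [/HB[i [Bx BP Bi]] /HC[j [Cy CQ Cj]]] PQU.
exists (i, j); split => //=.
  by move=> [a b] /= [/BP Pa /CQ Qb]; exact: PQU.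
by rewrite product_measure1E // mule_gt0.
Qed.

Lemma positive_base_plane :
  positive_base (mu \x mu)%E (fun z : measurableTypeR R * measurableTypeR R =>
    nbhs (z : R * R)).
Proof.
by have H := positive_base_prod positive_base_real positive_base_real; exact: H.
Qed.

Lemma positive_base_space :
  positive_base ((mu \x mu) \x mu)%E
    (fun z : measurableTypeR R * measurableTypeR R * measurableTypeR R =>
      nbhs (z : R * R * R)).
Proof.
have H nb1 nb2 : positive_base (mu \x mu)%E nb1 -> positive_base mu nb2 ->
    positive_base ((mu \x mu) \x mu)%E (fun z => filter_prod (nb1 z.1) (nb2 z.2)).
  exact: positive_base_prod.
exact: (H _ _ positive_base_plane positive_base_real).
Qed.

Lemma bounded_measure_plane
    (D : set (measurableTypeR R * measurableTypeR R)) (M : R) :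
  measurable D ->
  (forall z, D z -> `|z.1| <= M /\ `|z.2| <= M) -> ((mu \x mu)%E D < +oo)%E.
Proof.
move=> mD HD; pose I := `[- M, M]%classic : set (measurableTypeR R).
apply: (@le_lt_trans _ _ ((mu \x mu)%E (I `*` I))).
  apply: le_measure; rewrite ?inE //; first by apply: measurableX; exact: measurable_itv.
  by move=> z /HD[z1 z2]; split; rewrite /I /= in_itv /= -ler_norml.
rewrite product_measure1E; try exact: measurable_itv.
rewrite [X in (X * X)%E]lebesgue_measure_itv /=.
by case: ifP => _; rewrite ?mul0e ?ltry // -EFinB -EFinM ltry.
Qed.

Lemma bounded_measure_space
    (D : set (measurableTypeR R * measurableTypeR R * measurableTypeR R)) (M : R) :
  measurable D ->
  (forall z, D z -> [/\ `|z.1.1| <= M, `|z.1.2| <= M & `|z.2| <= M]) ->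
  (((mu \x mu) \x mu)%E D < +oo)%E.
Proof.
move=> mD HD; pose I := `[- M, M]%classic : set (measurableTypeR R).
have mI : measurable I by exact: measurable_itv.
apply: (@le_lt_trans _ _ (((mu \x mu) \x mu)%E ((I `*` I) `*` I))).
  apply: le_measure; rewrite ?inE //; first by apply: measurableX => //; exact: measurableX.
  by move=> z /HD[z1 z2 z3]; do 2?split; rewrite /I /= in_itv /= -ler_norml.
have mI2 : measurable (I `*` I) by exact: measurableX.
rewrite product_measure1E //= product_measure1E //.
rewrite [X in (X * X * X)%E]lebesgue_measure_itv /=.
by case: ifP => _; rewrite ?mul0e ?ltry // -EFinB -!EFinM ltry.
Qed.

(** * Integrals over a compact set through a chart *)

Section Chart.
Context d (X : measurableType d).
Variables (m : {measure set X -> \bar R}) (nb : X -> set_system X).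
Variables (phi : X -> 'rV[R]_3) (S : set 'rV[R]_3).
Hypothesis base : positive_base m nb.
Hypothesis nbP : forall x, Filter (nb x).
Hypothesis phi_continuous : forall x U, nbhs (phi x) U -> nb x (phi @^-1` U).
Hypothesis S_compact : compact S.
Let D : set X := phi @^-1` S.

Lemma open_preimage_measurable (U : set 'rV[R]_3) : open U -> measurable (phi @^-1` U).
Proof.
move=> oU; apply: positive_base_measurable base _ => x Ux.
by apply: phi_continuous; apply: open_nbhs_nbhs.
Qed.

Lemma chart_measurable : measurable D.
Proof.
rewrite -[D]setCK; apply: measurableC; rewrite /D preimage_setC.
apply: open_preimage_measurable; apply: closed_openC.
by apply: compact_closed => //; exact: norm_hausdorff.
Qed.

Lemma continuous_chart_measurable_fun (g : 'rV[R]_3 -> R) :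
  continuous g -> measurable_fun setT (g \o phi).
Proof.
move=> cg; apply: (measurability _ (measurable_realfun.RGenOInfty.measurableE R)).
move=> _ [_ [a ->] <-].
rewrite setTI comp_preimage; apply: open_preimage_measurable.
by apply: open_comp; [move=> x _; exact: cg|exact: interval_open].
Qed.

Hypothesis D_finite : (m D < +oo)%E.

Lemma continuous_integrable (g : 'rV[R]_3 -> R) :
  continuous g -> m.-integrable D (EFin \o (g \o phi)).
Proof.
move=> cg; apply: measurable_bounded_integrable => //.
- exact: chart_measurable.
- by apply: measurable_funTS; exact: continuous_chart_measurable_fun.
have /compact_bounded[M [Mr HM]] : compact (g @` S).
  by apply: continuous_compact => //; exact: continuous_subspaceT.
exists M; split=> // N MN z Dz; apply: (HM N MN); exists (phi z) => //.
Qed.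

(** The common form of the three integrals. Those over the body and over a face are instances by
    conversion; for an edge, the preimage of the closed edge is first identified with the parameter
    interval. *)
Definition chart_integral (g : 'rV[R]_3 -> R) : R := \int[m]_(z in D) g (phi z).

Lemma chart_integralD (g h : 'rV[R]_3 -> R) : continuous g -> continuous h ->
  chart_integral (fun x => g x + h x) = chart_integral g + chart_integral h.
Proof.
move=> cg ch; rewrite /chart_integral -RintegralD //.
- exact: chart_measurable.
- exact: continuous_integrable.
- exact: continuous_integrable.
Qed.

Lemma chart_integralZ (a : R) (g : 'rV[R]_3 -> R) : continuous g ->
  chart_integral (fun x => a * g x) = a * chart_integral g.
Proof.
move=> cg; rewrite /chart_integral -RintegralZl //.
- exact: chart_measurable.
- exact: continuous_integrable.
Qed.

(** A zero integral makes the nonnegative function vanish outside a null set. If it were positive at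
    a point interior to the domain, it would be positive on a base set of positive measure. *)
Lemma chart_integral_eq0 (g : 'rV[R]_3 -> R) : continuous g ->
  (forall x, 0 <= g x) -> chart_integral g = 0 ->
  forall z, nb z D -> g (phi z) = 0.
Proof.
move=> cg g0 Ig z Dz; apply: contrapT => /eqP gz.
have gz0 : 0 < g (phi z) by rewrite lt_def gz g0.
have intg := continuous_integrable cg.
have mg := measurable_int m intg.
have : (\int[m]_(z in D) `|(EFin \o (g \o phi)) z|)%E = 0%E.
  rewrite (eq_integral (EFin \o (g \o phi))) => [|y _]; last first.
    by rewrite gee0_abs // lee_fin; exact: g0.
  rewrite -[RHS](_ : (chart_integral g)%:E = _); last by rewrite Ig.
  rewrite /chart_integral /Rintegral fineK //.
  by apply: integrable_fin_num => //; exact: chart_measurable.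
move/(ae_eq_integral_abs _ chart_measurable mg) => [N [mN N0 HN]].
have /= : nb z (D `&` phi @^-1` [set x | 0 < g x]).
  apply: filterI => //; apply: phi_continuous; apply: open_nbhs_nbhs; split=> //.
  by apply: (@open_comp _ _ g [set r | 0 < r]); [move=> x _; exact: cg|exact: open_gt].
case: base => I [B [mB HB]] /HB[i [_ BU Bi]].
have : (m (B i) <= m N)%E.
  apply: le_measure; rewrite ?inE // => y /BU[Dy /= gy]; apply: HN => /= /(_ Dy)[E].
  by rewrite E ltxx in gy.
by rewrite N0 leNgt Bi.
Qed.

End Chart.

End ContinuousIntegrals.

(** * Continuity of the polynomial integrands *)

Section ContinuousFields.
Variable R : realType.
Implicit Type X : topologicalType.

Definition entrywise_continuous X (F : X -> 'rV[R]_3) : Prop :=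
  forall i, continuous (fun x => F x 0 i).

Lemma continuous_meval X n (h : X -> 'I_n -> R) (p : mpoly n R) :
  (forall i, continuous (h ^~ i)) -> continuous (fun x => meval (h x) p).
Proof.
move=> ch; elim/mpoly_alg_ind: p => [c|i|p q Hp Hq|p q Hp Hq].
- rewrite (_ : (fun x => _) = fun=> c); first exact: cst_continuous.
  by apply/funext => x; rewrite mevalC.
- rewrite (_ : (fun x => _) = h^~ i) //.
  by apply/funext => x; rewrite mevalXU.
- rewrite (_ : (fun x => _) = fun x => meval (h x) p + meval (h x) q).
    by move=> x; apply: cvgD; [exact: Hp|exact: Hq].
  by apply/funext => x; rewrite mevalD.
- rewrite (_ : (fun x => _) = fun x => meval (h x) p * meval (h x) q).
    by move=> x; apply: cvgM; [exact: Hp|exact: Hq].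
  by apply/funext => x; rewrite mevalM.
Qed.

Lemma continuous_horner_comp X (p : {poly R}) (h : X -> R) :
  continuous h -> continuous (fun x => p.[h x]).
Proof.
move=> ch; elim/poly_ind: p => [|p c Hp].
  rewrite (_ : (fun x => _) = fun=> 0); first exact: cst_continuous.
  by apply/funext => x; rewrite horner0.
rewrite (_ : (fun x => _) = fun x => p.[h x] * h x + c).
  by move=> x; apply: cvgD; [apply: cvgM; [exact: Hp|exact: ch]|exact: cvg_cst].
by apply/funext => x; rewrite !hornerE.
Qed.

Lemma continuous_mulR X (g h : X -> R) :
  continuous g -> continuous h -> continuous (fun x => g x * h x).
Proof. by move=> cg ch x; apply: cvgM; [exact: cg|exact: ch]. Qed.

Lemma entrywise_continuous_cst X (v : 'rV[R]_3) :
  entrywise_continuous (fun _ : X => v).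
Proof. by move=> i; exact: cst_continuous. Qed.

Lemma entrywise_continuousZ X (s : X -> R) (F : X -> 'rV[R]_3) :
  continuous s -> entrywise_continuous F ->
  entrywise_continuous (fun x => s x *: F x).
Proof.
move=> cs cF i; rewrite (_ : (fun x => _) = fun x => s x * F x 0 i).
  exact: continuous_mulR.
by apply/funext => x; rewrite mxE.
Qed.

Lemma entrywise_continuous_cross X (F G : X -> 'rV[R]_3) :
  entrywise_continuous F -> entrywise_continuous G ->
  entrywise_continuous (fun x => cross (F x) (G x)).
Proof.
move=> cF cG i; rewrite (_ : (fun x => _) = fun x =>
    F x 0 (i + 1) * G x 0 (i + 2) - F x 0 (i + 2) * G x 0 (i + 1)).
  by move=> x; apply: cvgB; apply: cvgM; by [exact: cF|exact: cG].
by apply/funext => x; rewrite mxE.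
Qed.

Lemma continuous_peval (p : mpoly 3 R) : continuous (peval p).
Proof. by apply: continuous_meval => i; exact: continuous_entry. Qed.

Lemma entrywise_continuous_veval (v : 'rV[mpoly 3 R]_3) :
  entrywise_continuous (veval v).
Proof.
move=> i; rewrite (_ : (fun x => _) = peval (v 0 i)); first exact: continuous_peval.
by apply/funext => x; rewrite mxE.
Qed.

Variable T : polyhedral_data R.

Lemma continuous_dot_sub (a t : 'rV[R]_3) :
  continuous (fun x : 'rV[R]_3 => dot (x - a) t).
Proof.
apply: continuous_dot => [|i]; last exact: cst_continuous.
apply: (@continuous_rowD _ _ id (fun=> - a)); first exact: continuous_entry.
by move=> i; exact: cst_continuous.
Qed.

Lemma continuous_feval (f : face T) (p : mpoly 2 R) : continuous (feval f p).
Proof. by apply: continuous_meval => i; exact: continuous_dot_sub. Qed.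

Lemma continuous_eeval (e : edge T) (p : {poly R}) : continuous (eeval e p).
Proof. by apply: continuous_horner_comp; exact: continuous_dot_sub. Qed.

Lemma ftan_fieldE (f : face T) (u : 'I_2 -> mpoly 2 R) x :
  ftan_field f u x = feval f (u 0) x *: ftan f 0 + feval f (u 1) x *: ftan f 1.
Proof.
rewrite /ftan_field !big_ord_recl big_ord0 addr0.
by congr (feval f (u _) x *: ftan f _ + feval f (u _) x *: ftan f _); exact: val_inj.
Qed.

Lemma entrywise_continuous_ftan_field (f : face T) (u : 'I_2 -> mpoly 2 R) :
  entrywise_continuous (ftan_field f u).
Proof.
rewrite (_ : ftan_field f u = fun x =>
    feval f (u 0) x *: ftan f 0 + feval f (u 1) x *: ftan f 1).
  by apply: continuous_rowD; apply: entrywise_continuousZ;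
    by [exact: continuous_feval|exact: entrywise_continuous_cst].
by apply/funext => x; rewrite ftan_fieldE.
Qed.

End ContinuousFields.

(** * Linearity and definiteness of the volume, face and edge integrals *)

Section PolyhedronIntegrals.
Variables (R : realType) (T : polyhedral_data R).
Hypothesis hT : is_polyhedron T.
Local Notation mu := (@lebesgue_measure R).

Lemma compact_function_bound (S : set 'rV[R]_3) (h : 'rV[R]_3 -> R) :
  compact S -> continuous h -> exists M, forall x, S x -> `|h x| <= M.
Proof.
move=> cS ch.
have /compact_bounded[M [_ HM]] : compact (h @` S).
  by apply: continuous_compact => //; exact: continuous_subspaceT.
(* Boundedness only provides the estimate for numbers strictly above [M]. *)
by exists (M + 1) => x Sx; apply: (HM (M + 1)); [rewrite ltrDl|exists x].
Qed.

Definition space_chart (z : R * R * R) : 'rV[R]_3 := vec3 z.1.1 z.1.2 z.2.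

Lemma space_chartE z : [/\ space_chart z 0 0 = z.1.1,
  space_chart z 0 1 = z.1.2 & space_chart z 0 2 = z.2].
Proof. by rewrite !mxE. Qed.

Lemma continuous_space_chart : continuous space_chart.
Proof.
have -> : space_chart = fun z : R * R * R =>
    z.1.1 *: vec3 1 0 0 + z.1.2 *: vec3 0 1 0 + z.2 *: vec3 0 0 1.
  by apply/funext => z; apply: row3P; rewrite !mxE /=; ring.
move=> z; apply: cvgD; [apply: cvgD|]; apply: cvgZr_tmp.
- by apply: cvg_comp; exact: cvg_fst.
- by apply: cvg_comp; [exact: cvg_fst|exact: cvg_snd].
- exact: cvg_snd.
Qed.

Lemma continuous_fchart (f : face T) : continuous (fchart f).
Proof.
move=> y; apply: cvgD; [apply: cvgD|]; first exact: cvg_cst.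
- by apply: cvgZr_tmp; exact: cvg_fst.
- by apply: cvgZr_tmp; exact: cvg_snd.
Qed.

Lemma fcoord_fchart (f : face T) (y : R * R) :
  fcoord f (fchart f y) 0 = y.1 /\ fcoord f (fchart f y) 1 = y.2.
Proof.
rewrite /fcoord fchart_sub !dotDl !dotZl !(ftan_orthonormal hT) /=.
by rewrite !mulr1 !mulr0 addr0 add0r.
Qed.

Lemma fset_compact (f : face T) : compact (fset f).
Proof.
apply: (subclosed_compact _ (body_compact hT)); first exact: fset_closed.
exact: fset_body.
Qed.

Lemma eset_compact (e : edge T) : compact (eset e).
Proof.
apply: continuous_compact; last exact: segment_compact.
exact/continuous_subspaceT/continuous_echart.
Qed.

Lemma echart_preimage (e : edge T) : echart e @^-1` eset e = `[0, elen e]%classic.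
Proof.
apply/seteqP; split=> [s [s' Hs' E]|s Hs]; last by exists s.
suff <- : s' = s by [].
have /(congr1 (dot (etan e))) : s' *: etan e = s *: etan e.
  by apply: (addrI (eorig e)).
by rewrite !dotZr (etan_unit hT) !mulr1.
Qed.

Lemma chart_body_measurable :
  measurable (space_chart @^-1` body T :
    set (measurableTypeR R * measurableTypeR R * measurableTypeR R)).
Proof.
apply: (chart_measurable (positive_base_space R)).
  by move=> x U; exact: continuous_space_chart.
exact: body_compact.
Qed.

Lemma body_measure_finite : (((mu \x mu) \x mu)%E (space_chart @^-1` body T) < +oo)%E.
Proof.
have [M0 H0] := compact_function_bound (body_compact hT) (@continuous_entry R 0).
have [M1 H1] := compact_function_bound (body_compact hT) (@continuous_entry R 1).
have [M2 H2] := compact_function_bound (body_compact hT) (@continuous_entry R 2).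
apply: (@bounded_measure_space _ _ (Num.max M0 (Num.max M1 M2))).
  exact: chart_body_measurable.
move=> z /[dup] /H0 + /[dup] /H1 + /H2; have [-> -> ->] := space_chartE z.
by rewrite !le_max => -> -> ->; rewrite !orbT.
Qed.

Lemma int_bodyD (g h : 'rV[R]_3 -> R) : continuous g -> continuous h ->
  int_body T (fun x => g x + h x) = int_body T g + int_body T h.
Proof.
apply: (chart_integralD (positive_base_space R) _ (body_compact hT) body_measure_finite).
by move=> x U; exact: continuous_space_chart.
Qed.

Lemma int_bodyZ (a : R) (g : 'rV[R]_3 -> R) : continuous g ->
  int_body T (fun x => a * g x) = a * int_body T g.
Proof.
apply: (chart_integralZ (positive_base_space R) _ (body_compact hT) body_measure_finite).
by move=> x U; exact: continuous_space_chart.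
Qed.

Lemma int_body_eq0 (g : 'rV[R]_3 -> R) : continuous g -> (forall x, 0 <= g x) ->
  int_body T g = 0 -> forall x, (body T)° x -> g x = 0.
Proof.
move=> cg g0 Ig x bx.
have Ex : x = space_chart (x 0 0, x 0 1, x 0 2).
  by have [? ? ?] := space_chartE (x 0 0, x 0 1, x 0 2); exact: row3P.
rewrite Ex; apply: (chart_integral_eq0 (positive_base_space R) _ _ (body_compact hT)
  body_measure_finite cg g0 Ig).
  by move=> z U; exact: continuous_space_chart.
by apply: continuous_space_chart; rewrite -Ex.
Qed.

Lemma face_measure_finite (f : face T) : ((mu \x mu)%E (floc f) < +oo)%E.
Proof.
have [M0 H0] := compact_function_bound (@fset_compact f)
  (@continuous_dot_sub R (forig f) (ftan f 0)).
have [M1 H1] := compact_function_bound (@fset_compact f)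
  (@continuous_dot_sub R (forig f) (ftan f 1)).
apply: (@bounded_measure_plane _ _ (Num.max M0 M1)).
  apply: (chart_measurable (positive_base_plane R) _ (@fset_compact f)).
  by move=> x U; exact: continuous_fchart.
move=> z /[dup] /H0 + /H1; have := fcoord_fchart f z; rewrite /fcoord => -[-> ->].
by rewrite !le_max => -> ->; rewrite !orbT.
Qed.

Lemma int_faceD (f : face T) (g h : 'rV[R]_3 -> R) : continuous g -> continuous h ->
  int_face f (fun x => g x + h x) = int_face f g + int_face f h.
Proof.
apply: (chart_integralD (positive_base_plane R) _ (@fset_compact f) (face_measure_finite f)).
by move=> x U; exact: continuous_fchart.
Qed.

Lemma int_faceZ (f : face T) (a : R) (g : 'rV[R]_3 -> R) : continuous g ->
  int_face f (fun x => a * g x) = a * int_face f g.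
Proof.
apply: (chart_integralZ (positive_base_plane R) _ (@fset_compact f) (face_measure_finite f)).
by move=> x U; exact: continuous_fchart.
Qed.

Lemma int_face_eq0 (f : face T) (g : 'rV[R]_3 -> R) :
  continuous g -> (forall x, 0 <= g x) ->
  int_face f g = 0 -> forall y, (floc f)° y -> g (fchart f y) = 0.
Proof.
move=> cg g0 Ig y fy.
apply: (chart_integral_eq0 (positive_base_plane R) _ _ (@fset_compact f)
  (face_measure_finite f) cg g0 Ig) => //.
by move=> z U; exact: continuous_fchart.
Qed.

Lemma eq_int_face (f : face T) (g h : 'rV[R]_3 -> R) :
  (forall y, g (fchart f y) = h (fchart f y)) -> int_face f g = int_face f h.
Proof. by move=> gh; apply: eq_Rintegral => y _; exact: gh. Qed.

Lemma int_edgeE (e : edge T) (g : 'rV[R]_3 -> R) :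
  int_edge e g = chart_integral mu (echart e) (eset e) g.
Proof. by rewrite /chart_integral echart_preimage. Qed.

Lemma edge_measure_finite (e : edge T) : (mu (echart e @^-1` eset e) < +oo)%E.
Proof. by rewrite echart_preimage lebesgue_measure_itv /=; case: ifP => _; rewrite ltry. Qed.

Lemma int_edgeD (e : edge T) (g h : 'rV[R]_3 -> R) : continuous g -> continuous h ->
  int_edge e (fun x => g x + h x) = int_edge e g + int_edge e h.
Proof.
move=> cg ch; rewrite !int_edgeE.
apply: (chart_integralD (positive_base_real R) _ (@eset_compact e) (edge_measure_finite e)) => //.
by move=> x U; exact: continuous_echart.
Qed.

Lemma int_edgeZ (e : edge T) (a : R) (g : 'rV[R]_3 -> R) : continuous g ->
  int_edge e (fun x => a * g x) = a * int_edge e g.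
Proof.
move=> cg; rewrite !int_edgeE.
apply: (chart_integralZ (positive_base_real R) _ (@eset_compact e) (edge_measure_finite e)) => //.
by move=> x U; exact: continuous_echart.
Qed.

Lemma eq_int_edge (e : edge T) (g h : 'rV[R]_3 -> R) :
  (forall x, eset e x -> g x = h x) -> int_edge e g = int_edge e h.
Proof.
by move=> gh; apply: eq_Rintegral => s; rewrite inE => Hs; apply: gh; exists s.
Qed.

End PolyhedronIntegrals.

(** * Finite spanning families of the polynomial spaces *)

Section SpanningFamilies.
Variable R : realType.

Lemma Pol_span n j (p : mpoly n R) : Pol j p <->
  exists c : bmultinom n j.+1 -> R, p = \sum_m c m *: mpolyX R (bmnm m).
Proof.
split=> [pj|[c ->]]; first by exists (fun m => mcoeff m p); exact: mpolywE.
elim/big_ind: _ => [|q r|m _]; [exact: Pol0|exact: PolD|].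
by apply/PolZ/(@PolW _ _ (mdeg m)); [rewrite -ltnS bmdeg|exact: PolX].
Qed.

Lemma VecPol_span j (v : 'rV[mpoly 3 R]_3) : VecPol j v <->
  exists c : 'I_3 * bmultinom 3 j.+1 -> R,
    v = \sum_k mpolyC 3 (c k) *: (mpolyX R (bmnm k.2) *: delta_mx 0 k.1).
Proof.
have E (c : 'I_3 * bmultinom 3 j.+1 -> R) i :
    (\sum_k mpolyC 3 (c k) *: (mpolyX R (bmnm k.2) *: delta_mx 0 k.1)
       : 'rV[mpoly 3 R]_3) 0 i = \sum_m c (i, m) *: mpolyX R (bmnm m).
  pose F i0 m := (mpolyC 3 (c (i0, m)) *: (mpolyX R (bmnm m) *: delta_mx 0 i0)
    : 'rV[mpoly 3 R]_3) 0 i.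
  rewrite summxE (eq_bigr (fun k => F k.1 k.2)) => [|[]//].
  rewrite -(pair_bigA _ F) /F /=.
  rewrite (bigD1 i) //= [X in _ + X]big1 ?addr0 => [|i' i'i].
    by apply: eq_bigr => m _; rewrite !mxE !eqxx mulr1 mul_mpolyC.
  by rewrite big1 // => m _; rewrite !mxE eqxx eq_sym (negbTE i'i) !mulr0.
split=> [vj|[c ->] i]; last by rewrite E; apply/Pol_span; exists (fun m => c (i, m)).
have [c Hc] := choice (fun i => (Pol_span j (v 0 i)).1 (vj i)).
exists (fun k => c k.1 k.2); apply/rowP => i; rewrite E; exact: Hc.
Qed.

End SpanningFamilies.

(** * Existence and uniqueness of the weak curl and the weak divergence *)

Section WeakOperators.
Variables (R : realType) (T : polyhedral_data R).
Hypothesis hT : is_polyhedron T.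
Implicit Type u : field2 T.

(** The body is non-empty and is the closure of its interior, which is therefore non-empty. *)
Lemma interior_body_ball : exists (x : 'rV[R]_3) (e : R),
  0 < e /\ forall y : 'rV[R]_3, (forall i, `|y 0 i - x 0 i| < e) -> (body T)° y.
Proof.
have [x bx] : (body T)° !=set0.
  have [x bx] := body_neq0 hT.
  have : closure (body T)° x by rewrite (body_regular hT).
  by move=> /(_ setT filterT)[y [iy _]]; exists y.
have /nbhs_ballP[e /= e0 He] := nbhs_interior bx.
exists x, e; split=> // y Hy; apply: He; split=> // i j.
by rewrite ord1 -ball_normE /= distrC; exact: Hy.
Qed.

Lemma interior_face_ball (f : face T) : exists (z : R * R) (e : R),
  0 < e /\ forall y : R * R, `|y.1 - z.1| < e -> `|y.2 - z.2| < e -> (floc f)° y.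
Proof.
have [_ [z fz _]] := face_neq0 hT f.
have /nbhs_ballP[e /= e0 He] := nbhs_interior fz.
exists z, e; split=> // y y1 y2; apply: He.
by split; rewrite -ball_normE /= distrC.
Qed.

Lemma peval_vanish_body (p : mpoly 3 R) :
  (forall x, (body T)° x -> peval p x = 0) -> p = 0.
Proof.
have [x [e [e0 He]]] := interior_body_ball => p0.
apply: meval_vanish => v; apply: (meval_vanish_box e0) v => v Hv.
have -> : meval v p = peval p (\row_i v i).
  by apply: meval_eq => i; rewrite mxE.
by apply: p0; apply: He => i; rewrite mxE; exact: Hv.
Qed.

Lemma feval_fchart (f : face T) (p : mpoly 2 R) y (v : 'I_2 -> R) :
  v 0 = y.1 -> v 1 = y.2 -> feval f p (fchart f y) = meval v p.
Proof.
have [y1 y2] := fcoord_fchart hT f y => v0 v1; apply: meval_eq.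
by case=> [[|[|//]] Hi]; [move: (etrans y1 (esym v0))|move: (etrans y2 (esym v1))];
  congr (fcoord _ _ _ = v _); exact: val_inj.
Qed.

Lemma feval_vanish_face (f : face T) (p : mpoly 2 R) :
  (forall y, (floc f)° y -> feval f p (fchart f y) = 0) -> p = 0.
Proof.
have [z [e [e0 He]]] := interior_face_ball f => p0.
apply: meval_vanish => v.
apply: (@meval_vanish_box _ _ _ (fun i => if i == 0 then z.1 else z.2) _ e0) v => v Hv.
rewrite -(@feval_fchart f p (v 0, v 1)) //.
by apply: p0; apply: He; [have := Hv 0|have := Hv 1].
Qed.

Lemma vevalD v w x : veval (v + w) x = veval v x + veval w x :> 'rV[R]_3.
Proof. by apply/rowP => i; rewrite !mxE /peval mevalD. Qed.

Lemma vevalZ a v x : veval (mpolyC 3 a *: v) x = a *: veval v x :> 'rV[R]_3.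
Proof. by apply/rowP => i; rewrite !mxE /peval mevalM mevalC. Qed.

Lemma veval0 x : veval 0 x = 0 :> 'rV[R]_3.
Proof. by apply/rowP => i; rewrite !mxE /peval meval0. Qed.

Lemma curlD (v w : 'rV[mpoly 3 R]_3) : curl (v + w) = curl v + curl w.
Proof. by apply/rowP => i; rewrite !mxE !mderivD; ring. Qed.

Lemma curlZ a (v : 'rV[mpoly 3 R]_3) : curl (mpolyC 3 a *: v) = mpolyC 3 a *: curl v.
Proof. by apply/rowP => i; rewrite !mxE !mderiv_mulC mulrBr. Qed.

Lemma gradD (p q : mpoly 3 R) : grad (p + q) = grad p + grad q.
Proof. by apply/rowP => i; rewrite !mxE mderivD. Qed.

Lemma gradZ a (p : mpoly 3 R) : grad (a *: p) = mpolyC 3 a *: grad p.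
Proof. by apply/rowP => i; rewrite !mxE mderivZ mul_mpolyC. Qed.

Lemma curl_grad (p : mpoly 3 R) : curl (grad p) = 0.
Proof. by apply/rowP => i; rewrite !mxE mderiv_comm subrr. Qed.

Lemma fevalD (f : face T) (p q : mpoly 2 R) x :
  feval f (p + q) x = feval f p x + feval f q x.
Proof. exact: mevalD. Qed.

Lemma fevalZ (f : face T) a (p : mpoly 2 R) x : feval f (a *: p) x = a * feval f p x.
Proof. exact: mevalZ. Qed.

Lemma fgradD (f : face T) (p q : mpoly 2 R) x :
  fgrad f (p + q) x = fgrad f p x + fgrad f q x.
Proof.
rewrite /fgrad /ftan_field -big_split; apply: eq_bigr => i _ /=.
by rewrite mderivD fevalD scalerDl.
Qed.

Lemma fgradZ (f : face T) a (p : mpoly 2 R) x : fgrad f (a *: p) x = a *: fgrad f p x.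
Proof.
rewrite /fgrad /ftan_field scaler_sumr; apply: eq_bigr => i _.
by rewrite mderivZ fevalZ scalerA.
Qed.

Let cont_dot_veval (v w : 'rV[mpoly 3 R]_3) :
  continuous (fun x => dot (veval v x) (veval w x)).
Proof. by apply: continuous_dot; exact: entrywise_continuous_veval. Qed.

Let cont_normal_flux (f : face T) (p : mpoly 2 R) (q : 'rV[R]_3 -> R) n n' :
  continuous q -> continuous (fun x => dot (feval f p x *: n) (q x *: n')).
Proof.
move=> cq; apply: continuous_dot; apply: entrywise_continuousZ => //;
  by [exact: continuous_feval|exact: entrywise_continuous_cst].
Qed.

Let cont_tangent_flux (f : face T) (w : 'I_2 -> mpoly 2 R) (F : 'rV[R]_3 -> 'rV[R]_3) n :
  entrywise_continuous F ->
  continuous (fun x => dot (ftan_field f w x) (cross (F x) n)).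
Proof.
move=> cF; apply: continuous_dot; first exact: entrywise_continuous_ftan_field.
by apply: entrywise_continuous_cross => //; exact: entrywise_continuous_cst.
Qed.

Let cont_edge_flux (e : edge T) (f : face T) p q (t t' : 'rV[R]_3) :
  continuous (fun x => dot (eeval e p x *: t) (feval f q x *: t')).
Proof.
apply: continuous_dot; apply: entrywise_continuousZ; try exact: entrywise_continuous_cst.
  exact: continuous_eeval.
exact: continuous_feval.
Qed.

Lemma sum_lin (V : zmodType) (J : finType) (P : pred J) (F G H : J -> V) :
  (forall j, P j -> F j = G j + H j) ->
  \sum_(j | P j) F j = \sum_(j | P j) G j + \sum_(j | P j) H j.
Proof. by move=> E; rewrite -big_split; exact: eq_bigr. Qed.

Lemma vector_form_definite (w : 'rV[mpoly 3 R]_3) :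
  int_body T (fun x => dot (veval w x) (veval w x)) = 0 -> w = 0.
Proof.
move=> w0.
have g0 (x : 'rV[R]_3) : 0 <= dot (veval w x) (veval w x).
  by apply: sumr_ge0 => i _; rewrite -expr2 sqr_ge0.
have Hx := int_body_eq0 hT (@cont_dot_veval w w) g0 w0.
apply/rowP => i; rewrite [RHS]mxE; apply: peval_vanish_body => x /Hx.
have -> : peval (w 0 i) x = veval w x 0 i by rewrite mxE.
move/eqP; rewrite psumr_eq0 => [/allP/(_ i)|j _]; last by rewrite -expr2 sqr_ge0.
by rewrite mem_index_enum -expr2 sqrf_eq0 => /(_ isT)/eqP.
Qed.

Lemma volume_form_definite (p : mpoly 3 R) :
  int_body T (fun x => peval p x * peval p x) = 0 -> p = 0.
Proof.
move=> p0.
have c : continuous (fun x => peval p x * peval p x).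
  by apply: continuous_mulR; exact: continuous_peval.
have g0 (x : 'rV[R]_3) : 0 <= peval p x * peval p x by rewrite -expr2 sqr_ge0.
apply: peval_vanish_body => x /(int_body_eq0 hT c g0 p0)/eqP.
by rewrite -expr2 sqrf_eq0 => /eqP.
Qed.

Lemma face_form_definite (f : face T) (p : mpoly 2 R) :
  int_face f (fun x => dot (feval f p x *: fnrm f) (feval f p x *: fnrm f)) = 0 ->
  p = 0.
Proof.
have E x : dot (feval f p x *: fnrm f) (feval f p x *: fnrm f) = feval f p x ^+ 2.
  by rewrite dotZl dotZr (fnrm_unit hT) mulr1 expr2.
move=> p0; have c := @cont_normal_flux f p _ (fnrm f) (fnrm f) (@continuous_feval R T f p).
have g0 x : 0 <= dot (feval f p x *: fnrm f) (feval f p x *: fnrm f).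
  by rewrite E sqr_ge0.
apply: feval_vanish_face => y /(int_face_eq0 hT c g0 p0)/eqP.
by rewrite E sqrf_eq0 => /eqP.
Qed.

Lemma weak_curl_body_exists a u : exists w, unique (is_weak_curl_body a u) w.
Proof.
apply: (@riesz_representation _ _ (fun c v => mpolyC 3 c *: v) (@VecPol R a) _ _
  (fun w theta => int_body T (fun x => dot (veval w x) (veval theta x)))
  (fun theta => int_body T (fun x => dot (veval (u2o u) x) (veval (curl theta) x)) +
    \sum_(f : face T) int_face f (fun x =>
      dot (ftan_field f (u2f u f) x) (cross (veval theta x) (nout f))))
  (VecPol_span a)).
- move=> v w t; rewrite -int_bodyD //; congr int_body.
  by apply/funext => x; rewrite vevalD dotDl.
- move=> v w t; rewrite -int_bodyD //; congr int_body.
  by apply/funext => x; rewrite vevalD dotDr.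
- move=> c v w; rewrite -int_bodyZ //; congr int_body.
  by apply/funext => x; rewrite vevalZ dotZl.
- move=> c v w; rewrite -int_bodyZ //; congr int_body.
  by apply/funext => x; rewrite vevalZ dotZr.
- exact: vector_form_definite.
- move=> v w; rewrite curlD addrACA; congr (_ + _).
    rewrite -int_bodyD //; congr int_body.
    by apply/funext => x; rewrite vevalD dotDr.
  apply: sum_lin => f _.
  rewrite -int_faceD //; try by apply: cont_tangent_flux; exact: entrywise_continuous_veval.
  by congr int_face; apply/funext => x; rewrite vevalD crossDl dotDr.
- move=> c v; rewrite curlZ mulrDr; congr (_ + _).
    rewrite -int_bodyZ //; congr int_body.
    by apply/funext => x; rewrite vevalZ dotZr.
  rewrite mulr_sumr; apply: eq_bigr => f _.
  rewrite -int_faceZ //; try by apply: cont_tangent_flux; exact: entrywise_continuous_veval.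
  by congr int_face; apply/funext => x; rewrite vevalZ crossZl dotZr.
Qed.

Lemma weak_curl_face_exists b u (f : face T) : exists w, unique (is_weak_curl_face b u f) w.
Proof.
apply: (@riesz_representation _ _ *:%R (@Pol R 2 b) _ _
  (fun w tau => int_face f (fun x =>
     dot (feval f w x *: fnrm f) (feval f tau x *: fnrm f)))
  (fun tau => int_face f (fun x =>
      dot (ftan_field f (u2f u f) x) (cross (fgrad f tau x) (fnrm f))) +
    \sum_(e : edge T | incident e f) int_edge e (fun x =>
      dot (eeval e (u2e u e) x *: etan e) (feval f tau x *: btan f e)))
  (@Pol_span R 2 b)).
- move=> v w t; rewrite -int_faceD //; try exact/cont_normal_flux/continuous_feval.
  by congr int_face; apply/funext => x; rewrite fevalD scalerDl dotDl.
- move=> v w t; rewrite -int_faceD //; try exact/cont_normal_flux/continuous_feval.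
  by congr int_face; apply/funext => x; rewrite fevalD scalerDl dotDr.
- move=> c v w; rewrite -int_faceZ //; try exact/cont_normal_flux/continuous_feval.
  by congr int_face; apply/funext => x; rewrite fevalZ -scalerA dotZl.
- move=> c v w; rewrite -int_faceZ //; try exact/cont_normal_flux/continuous_feval.
  by congr int_face; apply/funext => x; rewrite fevalZ -scalerA dotZr.
- exact: face_form_definite.
- move=> v w; rewrite addrACA; congr (_ + _).
    rewrite -int_faceD //; try by apply: cont_tangent_flux; exact: entrywise_continuous_ftan_field.
    by congr int_face; apply/funext => x; rewrite fgradD crossDl dotDr.
  apply: sum_lin => e _; rewrite -int_edgeD //.
  by congr int_edge; apply/funext => x; rewrite fevalD scalerDl dotDr.
- move=> c v; rewrite mulrDr; congr (_ + _).
    rewrite -int_faceZ //; try by apply: cont_tangent_flux; exact: entrywise_continuous_ftan_field.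
    by congr int_face; apply/funext => x; rewrite fgradZ crossZl dotZr.
  rewrite mulr_sumr; apply: eq_bigr => e _; rewrite -int_edgeZ //.
  by congr int_edge; apply/funext => x; rewrite fevalZ -scalerA dotZr.
Qed.

Lemma weak_div_exists c (w : field3 T) : exists d, unique (is_weak_div c w) d.
Proof.
have cN (f : face T) (p : mpoly 3 R) :
    continuous (fun x => dot (feval f (w3f w f) x *: fnrm f) (peval p x *: nout f)).
  by apply: cont_normal_flux; exact: continuous_peval.
have pD (p q : mpoly 3 R) x : peval (p + q) x = peval p x + peval q x by exact: mevalD.
have pZ a (p : mpoly 3 R) x : peval (a *: p) x = a * peval p x by exact: mevalZ.
have cM (p q : mpoly 3 R) : continuous (fun x => peval p x * peval q x).
  by apply: continuous_mulR; exact: continuous_peval.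
apply: (@riesz_representation _ _ *:%R (@Pol R 3 c) _ _
  (fun d tau => int_body T (fun x => peval d x * peval tau x))
  (fun tau => - int_body T (fun x => dot (veval (w3o w) x) (veval (grad tau) x)) +
    \sum_(f : face T) int_face f (fun x =>
      dot (feval f (w3f w f) x *: fnrm f) (peval tau x *: nout f)))
  (@Pol_span R 3 c)).
- move=> p q t; rewrite -int_bodyD //; congr int_body.
  by apply/funext => x; rewrite pD mulrDl.
- move=> p q t; rewrite -int_bodyD //; congr int_body.
  by apply/funext => x; rewrite pD mulrDr.
- move=> a p q; rewrite -int_bodyZ //; congr int_body.
  by apply/funext => x; rewrite pZ mulrA.
- move=> a p q; rewrite -int_bodyZ //; congr int_body.
  by apply/funext => x; rewrite pZ mulrCA.
- exact: volume_form_definite.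
- move=> p q; rewrite gradD addrACA -opprD; congr (- _ + _).
    rewrite -int_bodyD //; congr int_body.
    by apply/funext => x; rewrite vevalD dotDr.
  apply: sum_lin => f _; rewrite -int_faceD //.
  by congr int_face; apply/funext => x; rewrite pD scalerDl dotDr.
- move=> a p; rewrite gradZ mulrDr mulrN; congr (- _ + _).
    rewrite -int_bodyZ //; congr int_body.
    by apply/funext => x; rewrite vevalZ dotZr.
  rewrite mulr_sumr; apply: eq_bigr => f _; rewrite -int_faceZ //.
  by congr int_face; apply/funext => x; rewrite pZ -scalerA dotZr.
Qed.

End WeakOperators.

(** * Restriction of polynomials in space to a face *)

Section FaceRestriction.
Variables (R : realType) (T : polyhedral_data R).
Hypothesis hT : is_polyhedron T.

(** Formal composition with [fchart f]: polynomials on a face are written in its own two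
    coordinates, so a test function has to be rewritten in them. *)
Definition frestrict (f : face T) (p : mpoly 3 R) : mpoly 2 R :=
  mmap (@mpolyC 2 R) (fun i => mpolyC 2 (forig f 0 i) +
    \sum_(j < 2) ftan f j 0 i *: mpolyX R (mnm1 j)) p.

Lemma Pol_frestrict (f : face T) j (p : mpoly 3 R) :
  Pol j p -> Pol j (frestrict f p).
Proof.
apply: Pol_mmap => i; apply: PolD; first exact/(PolW (leq0n 1))/PolC.
elim/big_ind: _ => [|q r|k _]; [exact: Pol0|exact: PolD|].
by apply/PolZ/(@PolW _ _ (mdeg (mnm1 k))); [rewrite mdeg1|exact: PolX].
Qed.

Definition in_plane (f : face T) (x : 'rV[R]_3) : Prop :=
  dot (x - forig f) (fnrm f) = 0.

Lemma face_frame_expand (f : face T) v : v =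
  dot v (ftan f 0) *: ftan f 0 + dot v (ftan f 1) *: ftan f 1 + dot v (fnrm f) *: fnrm f.
Proof.
by apply: orthonormal_expand; rewrite ?(ftan_orthonormal hT) ?(fnrm_unit hT) //
  dotC (fnrm_orthogonal hT).
Qed.

Lemma fchart_in_plane (f : face T) y : in_plane f (fchart f y).
Proof.
rewrite /in_plane fchart_sub dotDl !dotZl ![dot (ftan _ _) _]dotC.
by rewrite !(fnrm_orthogonal hT) !mulr0 addr0.
Qed.

Lemma feval_frestrict (f : face T) (p : mpoly 3 R) x :
  in_plane f x -> feval f (frestrict f p) x = peval p x.
Proof.
move=> px; rewrite /feval /frestrict /peval.
(* In the plane of the face the normal component vanishes, so [x] is recovered from its two face
   coordinates. *)
have Ex : x = forig f + fcoord f x 0 *: ftan f 0 + fcoord f x 1 *: ftan f 1.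
  have := face_frame_expand f (x - forig f); rewrite px scale0r addr0 => E.
  by rewrite -[LHS](subrK (forig f)) {1}E addrC addrA.
elim/mpoly_alg_ind: p => [c|i|p q Hp Hq|p q Hp Hq].
- by rewrite mmapC !mevalC.
- rewrite mmapX mmap1U mevalXU mevalD mevalC {2}Ex !mxE -addrA; congr (_ + _).
  rewrite !big_ord_recl big_ord0 addr0 mevalD !mevalZ !mevalXU.
  rewrite mulrC [_ * fcoord f x _]mulrC.
  by congr (fcoord f x _ * ftan f _ 0 i + fcoord f x _ * ftan f _ 0 i); exact: val_inj.
- by rewrite mmapD !mevalD Hp Hq.
- by rewrite rmorphM !mevalM Hp Hq.
Qed.

Lemma mderiv_frestrict (f : face T) (p : mpoly 3 R) (j : 'I_2) :
  mderiv j (frestrict f p) = \sum_i ftan f j 0 i *: frestrict f (mderiv i p).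
Proof.
rewrite /frestrict (@mmap_chain_rule _ _ _ (@mpolyC 2 R) _ (mderiv j)).
- apply: eq_bigr => i _; rewrite mulrC -mul_mpolyC; congr (_ * _).
  rewrite mderivD mderivC add0r raddf_sum (bigD1 j) //= big1 => [|k kj].
    by rewrite mderivZ mderivX mnm1E eqxx -{1}[mnm1 j]add0m addmK mpolyX0 scale1r addr0 alg_mpolyC.
  by rewrite mderivZ mderivX mnm1E eq_sym eq_sym (negbTE kj) scale0r scaler0.
- exact: mderivD.
- exact: mderivM.
- exact: mderivC.
Qed.

(** By the chain rule, the derivatives of the restriction are the components of the gradient along
    the tangent frame; only the normal component is lost. *)
Lemma fgrad_frestrict (f : face T) (p : mpoly 3 R) x : in_plane f x ->
  veval (grad p) x =
  fgrad f (frestrict f p) x + dot (veval (grad p) x) (fnrm f) *: fnrm f.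
Proof.
move=> px; rewrite [LHS](face_frame_expand f); congr (_ + _).
have E j : feval f (mderiv j (frestrict f p)) x = dot (veval (grad p) x) (ftan f j).
  rewrite mderiv_frestrict /feval raddf_sum; apply: eq_bigr => i _ /=.
  by rewrite mevalZ -/(feval f _ x) feval_frestrict // !mxE mulrC.
by rewrite /fgrad ftan_fieldE !E.
Qed.

End FaceRestriction.

(** * The weak divergence of a weak curl *)

Section WeakComplex.
Variables (R : realType) (T : polyhedral_data R).
Hypothesis hT : is_polyhedron T.
Implicit Type u : field2 T.

(** The sets from which [xget] chooses have exactly one element, so the default value 0 is never
    returned for lack of a solution. *)
Lemma weak_curlP a b u : unique (is_weak_curl a b u) (weak_curl a b u).
Proof.
have [w0 [Hw0 Uw0]] := weak_curl_body_exists hT a u.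
have E0 : xget 0 [set w | is_weak_curl_body a u w] = w0.
  by apply: esym; apply: Uw0; exact: (xgetPex 0 (ex_intro _ w0 Hw0)).
have Ef f : unique (is_weak_curl_face b u f) (xget 0 [set w | is_weak_curl_face b u f w]).
  have [w [Hw Uw]] := weak_curl_face_exists hT b u f.
  have -> : xget 0 [set w | is_weak_curl_face b u f w] = w; last by split.
  by apply: esym; apply: Uw; exact: (xgetPex 0 (ex_intro _ w Hw)).
split; first by split=> /=; [rewrite E0|move=> f; case: (Ef f)].
case=> w wf [/= Hw Hf]; rewrite /weak_curl E0 (Uw0 _ Hw); congr Field3.
by apply/funext => f; case: (Ef f) => _; apply; exact: Hf.
Qed.

Lemma weak_divP c (w : field3 T) : unique (is_weak_div c w) (weak_div c w).
Proof.
have [d [Hd Ud]] := weak_div_exists hT c w.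
have -> : weak_div c w = d; last by split.
by apply: esym; apply: Ud; exact: (xgetPex 0 (ex_intro _ d Hd)).
Qed.

Lemma weak_curl_space a b u : space3 a b (weak_curl a b u).
Proof. by have [[[H _] Hf] _] := weak_curlP a b u; split=> // f; case: (Hf f). Qed.

Lemma weak_div_space c (w : field3 T) : Pol c (weak_div c w).
Proof. by have [[]] := weak_divP c w. Qed.

Lemma nout_sign (f : face T) : nout f = dot (nout f) (fnrm f) *: fnrm f.
Proof.
case: (nout_normal hT f) => E; rewrite E ?dotNl (fnrm_unit hT).
  by rewrite scale1r.
by rewrite scaleN1r.
Qed.

(* Tested against a potential gradient, the tangential field of a face only
   sees the gradient on the face. *)
Lemma face_gradient_flux u (f : face T) (tau : mpoly 3 R) :
  int_face f (fun x =>
    dot (ftan_field f (u2f u f) x) (cross (veval (grad tau) x) (nout f))) =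
  dot (nout f) (fnrm f) * int_face f (fun x =>
    dot (ftan_field f (u2f u f) x) (cross (fgrad f (frestrict f tau) x) (fnrm f))).
Proof.
rewrite -int_faceZ //; last first.
  apply: continuous_dot; first exact: entrywise_continuous_ftan_field.
  by apply: entrywise_continuous_cross;
    [exact: entrywise_continuous_ftan_field|exact: entrywise_continuous_cst].
apply: eq_int_face => y; rewrite {1}nout_sign crossZr dotZr; congr (_ * dot _ _).
rewrite (fgrad_frestrict hT tau (fchart_in_plane hT f y)).
by rewrite crossDl crossZl crossuu scaler0 addr0.
Qed.

Lemma edge_flux u (e : edge T) (f : face T) (tau : mpoly 3 R) : incident e f ->
  int_edge e (fun x => dot (eeval e (u2e u e) x *: etan e)
    (feval f (frestrict f tau) x *: btan f e)) =
  dot (etan e) (btan f e) * int_edge e (fun x => eeval e (u2e u e) x * peval tau x).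
Proof.
move=> ef; rewrite -int_edgeZ //; last first.
  by apply: continuous_mulR; [exact: continuous_eeval|exact: continuous_peval].
apply: eq_int_edge => x ex; rewrite dotZl dotZr feval_frestrict //; first by ring.
by apply: (fset_plane hT); exact: (eset_fset hT ef).
Qed.

(** The first degree bound admits [grad tau] as a test field for the curl in the body, the second
    admits the restrictions of [tau] as test functions on the faces. *)
Lemma weak_div_weak_curl a b c u (w : field3 T) :
  (c <= a.+1)%N -> (c <= b)%N -> is_weak_curl a b u w -> is_weak_div c w 0.
Proof.
move=> ca cb [[_ Hw] Hf]; split=> [|tau tauc]; first exact: Pol0.
have -> : int_body T (fun x => peval 0 x * peval tau x) = 0.
  rewrite (_ : (fun x => _) = fun x => 0 * peval tau x).
    by rewrite int_bodyZ ?mul0r //; exact: continuous_peval.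
  by apply/funext => x; rewrite /peval meval0.
have gt : VecPol a (grad tau).
  by move=> i; rewrite mxE; apply/Pol_mderiv/(PolW ca).
rewrite Hw // curl_grad.
have -> : int_body T (fun x => dot (veval (u2o u) x) (veval 0 x)) = 0.
  rewrite (_ : (fun x => _) = fun x => 0 * peval tau x).
    by rewrite int_bodyZ ?mul0r //; exact: continuous_peval.
  by apply/funext => x; rewrite veval0 dot0r mul0r.
pose s (f : face T) := dot (nout f) (fnrm f).
pose ie (e : edge T) := int_edge e (fun x => eeval e (u2e u e) x * peval tau x).
(* Each face term of the divergence splits into the face term of the body curl tested with
   [grad tau], which will cancel against the volume term, and edge integrals with signs. *)
have E f : int_face f (fun x =>
      dot (feval f (w3f w f) x *: fnrm f) (peval tau x *: nout f)) =
    int_face f (fun x =>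
      dot (ftan_field f (u2f u f) x) (cross (veval (grad tau) x) (nout f))) +
    \sum_(e | incident e f) s f * dot (etan e) (btan f e) * ie e.
  have [_ /(_ (frestrict f tau)) Hff] := Hf f.
  rewrite face_gradient_flux -/(s f).
  have <- : s f * (\sum_(e : edge T | incident e f) int_edge e (fun x =>
      dot (eeval e (u2e u e) x *: etan e)
          (feval f (frestrict f tau) x *: btan f e))) =
      \sum_(e | incident e f) s f * dot (etan e) (btan f e) * ie e.
    by rewrite mulr_sumr; apply: eq_bigr => e ef; rewrite edge_flux // mulrA.
  rewrite -mulrDr -Hff; last exact/Pol_frestrict/(PolW cb).
  rewrite -int_faceZ //; last first.
    by apply: continuous_dot; apply: entrywise_continuousZ;
      by [exact: continuous_feval|exact: entrywise_continuous_cst].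
  apply: eq_int_face => y; rewrite (feval_frestrict hT tau (fchart_in_plane hT f y)).
  by rewrite {1}nout_sign -/(s f) !dotZr; ring.
rewrite add0r (eq_bigr _ (fun f _ => E f)) big_split /= addKr.
(* Summed edge by edge, the integral [ie e] does not depend on the face and factors out of the sum
   of the signs. *)
rewrite (exchange_big_dep xpredT) //= big1 // => e _.
by rewrite -mulr_suml (edge_orientation hT) mul0r.
Qed.

Lemma weak_div_curl0 a b c u : (c <= a.+1)%N -> (c <= b)%N ->
  weak_div c (weak_curl a b u) = 0.
Proof.
move=> ca cb; have [_ U] := weak_divP c (weak_curl a b u).
have [H _] := weak_curlP a b u.
by apply: U; exact: weak_div_weak_curl ca cb H.
Qed.

End WeakComplex.

Theorem lemma3p2 (R : realType) (T : polyhedral_data R) (hT : is_polyhedron T) :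
  (forall k : nat,
    [/\ (forall u : field2 T, V2 k u ->
           V3 k (weak_curl k k u) /\
           unique (is_weak_curl k k u) (weak_curl k k u)),
        (forall w : field3 T, V3 k w ->
           V4 k (weak_div k w) /\ unique (is_weak_div k w) (weak_div k w))
      & (forall u : field2 T, V2 k u -> weak_div k (weak_curl k k u) = 0)]) /\
  (forall k : nat, (3 <= k)%N ->
    [/\ (forall u : field2 T, W2 (k - 1) u ->
           W3 (k - 2) (weak_curl (k - 2) (k - 3) u) /\
           unique (is_weak_curl (k - 2) (k - 3) u)
                  (weak_curl (k - 2) (k - 3) u)),
        (forall w : field3 T, W3 (k - 2) w ->
           W4 (k - 3) (weak_div (k - 3) w) /\
           unique (is_weak_div (k - 3) w) (weak_div (k - 3) w))
      & (forall u : field2 T, W2 (k - 1) u ->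
           weak_div (k - 3) (weak_curl (k - 2) (k - 3) u) = 0)]).
Proof.
split=> k.
  split=> [u _|w _|u _].
  - by split; [exact: weak_curl_space|exact: weak_curlP].
  - by split; [exact: weak_div_space|exact: weak_divP].
  - exact: weak_div_curl0.
move=> k3; split=> [u _|w _|u _].
- by split; [rewrite /W3 -subnDA; exact: weak_curl_space|exact: weak_curlP].
- by split; [exact: weak_div_space|exact: weak_divP].
- by apply: weak_div_curl0 => //; rewrite leqW // leq_sub2l.
Qed.
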